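(* Assume (A1), (A3), (A4), (A5), (A6) of the context. Let $\{\bm x_{i,t}\}_{t=1}^T$ and $\{\bm y_{i,t}\}_{t=1}^T$, $i\in[m]$, be generated by Algorithm BanODCMD with $$\eta=\frac{1}{\overline p\,\overline p_*\,d\sqrt T},\qquad \rho_t=\mathcal O\Big(\frac1{t^{3/2}}\Big),\qquad \delta=\frac1{\sqrt T},\qquad \xi=\frac{\delta}{\underline R},\qquad t\in[T].$$ Then, for all $T\ge1$ (for which $\xi<1$) and any $j\in[m]$, $$\mathbb E\big[\overline{\mathrm{Reg}}_j(T)\big]=\mathcal O\Big(\frac{\overline p\,\overline p_*\,d}{\sqrt T}\Big).$$
   Context: Notation: $[m]=\{1,\dots,m\}$; $\|\cdot\|$ is a norm on $\mathbb R^d$ with dual norm $\|\bm x\|_*=\max_{\|\bm y\|=1}\langle \bm x,\bm y\rangle$; $\|\cdot\|_2$ is the Euclidean norm; $\overline p,\overline p_*$ are constants with $\|\bm x\|\le\overline p\|\bm x\|_2$ and $\|\bm x\|_*\le\overline p_*\|\bm x\|_2$ for all $\bm x$. $\mathbb B_R$ is the Euclidean ball of radius $R$ centered at the origin. For positive sequences, $a_t=\mathcal O(b_t)$ means $\limsup_{t\to\infty}a_t/b_t<\infty$; the horizon is $T$, the algorithm is run with the stated parameters for each $T$, and the constant implied in $\rho_t=\mathcal O(t^{-3/2})$ does not depend on $t$ or $T$. Problem: $\mathcal K\subseteq\mathbb R^d$ is a convex constraint set, $\ell_{i,t}:\mathbb R^d\to\mathbb R$ is the convex loss function of node $i\in[m]$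 at round $t\in[T]$, and $r$ is a convex, possibly nonsmooth, regularization function. Let $\bm x^\star=\arg\min_{\bm x\in\mathcal K}\sum_{t=1}^T\sum_{j=1}^m(\ell_{j,t}(\bm x)+r(\bm x))$. The average regularized regret of node $i$ over $T$ rounds is $$\overline{\mathrm{Reg}}_i(T)=\frac1T\sum_{t=1}^T\sum_{j=1}^m(\ell_{j,t}(\bm x_{i,t})+r(\bm x_{i,t}))-\frac1T\sum_{t=1}^T\sum_{j=1}^m(\ell_{j,t}(\bm x^\star)+r(\bm x^\star)).$$ Network: $\mathcal G_t=(\mathcal V,\mathcal E_t)$ with $\mathcal V=[m]$, weight matrix $\bm P(t)\in\mathbb R^{m\times m}$, and $\mathcal E_t=\{\{i,j\}: [\bm P(t)]_{ij}>0\}$. Bregman divergence: for a function $\omega:\mathbb R^d\to\mathbb R$, $V_\omega(\bm x,\bm y)=\omega(\bm x)-\omega(\bm y)-\langle\nabla\omega(\bm y),\bm x-\bm y\rangle$. Assumptions (all constants are independent of $T$). (A1) (a) $\bm P(t)$ is doubly stochastic for all $t\ge1$; (b) there is $\zeta>0$ such that $[\bm P(t)]_{ii}\ge\zeta$ for all $i$ and $t\ge1$, and $[\bm P(t)]_{ij}\ge\zeta$ if $\{i,j\}\in\mathcal E_t$; (c) there is an integer $B\ge1$ such that the graph $(\mathcal V,\mathcal E_{kB+1}\cup\dots\cup\mathcal E_{(k+1)B})$ is strongly connected for all $k\ge0$. (A3) Each $\ell_{i,t}$ is $G_\ell$-Lipschitz over $\mathcal K$ with respect to $\|\cdot\|$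 (so that its (sub)gradients on $\mathcal K$ satisfy $\|\nabla\ell_{i,t}(\bm x)\|_*\le G_\ell$), and $r$ is $G_r$-Lipschitz over $\mathcal K$ with respect to $\|\cdot\|$. (A4) $\omega$ is $\sigma_\omega$-strongly convex on $\mathcal K$ with respect to $\|\cdot\|$, i.e. $\omega(\bm x)\ge\omega(\bm y)+\langle\nabla\omega(\bm y),\bm x-\bm y\rangle+\frac{\sigma_\omega}{2}\|\bm x-\bm y\|^2$, and $\|\nabla\omega(\bm x)-\nabla\omega(\bm y)\|_*\le G_\omega\|\bm x-\bm y\|$, for all $\bm x,\bm y\in\mathcal K$. (A5) $V_\omega(\bm x,\cdot)$ is convex in its second argument for every fixed $\bm x$, i.e. $V_\omega(\bm x,\sum_i\alpha_i\bm y_i)\le\sum_i\alpha_iV_\omega(\bm x,\bm y_i)$ for convex weights $\alpha_i$. (A6) $\mathbb B_{\underline R}\subseteq\mathcal K\subseteq\mathbb B_{\overline R}$. Algorithm BanODCMD (step size $\eta>0$, errors $\rho_t\ge0$, exploration parameter $\delta>0$, shrinkage parameter $\xi$): write $(1-\xi)\mathcal K=\{(1-\xi)\bm x:\bm x\in\mathcal K\}$ and initialize $\bm x_{i,1}=\arg\min_{\bm x\in(1-\xi)\mathcal K}\omega(\bm x)$ for $i\in[m]$. For $t=1,\dots,T$, each node $i$ draws a fresh unit vector $\bm u_{i,t}$ ($\|\bm u_{i,t}\|_2=1$) uniformly at random (independently of the past), queries $\ell_{i,t}(\bm x_{i,t}\pm\delta\bm u_{i,t})$, and sets $$\breve{\bm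 g}_{i,t}=\frac{d}{2\delta}\big(\ell_{i,t}(\bm x_{i,t}+\delta\bm u_{i,t})-\ell_{i,t}(\bm x_{i,t}-\delta\bm u_{i,t})\big)\bm u_{i,t}.$$ With $F_{i,t}(\bm x)=\langle\breve{\bm g}_{i,t},\bm x\rangle+r(\bm x)+\frac1\eta V_\omega(\bm x,\bm x_{i,t})$ and $\bm y_{i,t}^\star=\arg\min_{\bm x\in(1-\xi)\mathcal K}F_{i,t}(\bm x)$, it computes some $\bm y_{i,t}\in(1-\xi)\mathcal K$ with $F_{i,t}(\bm y_{i,t})\le F_{i,t}(\bm y_{i,t}^\star)+\rho_t$, and sets $\bm x_{i,t+1}=\sum_{j=1}^m[\bm P(t)]_{ij}\bm y_{j,t}$. The expectation $\mathbb E$ is over the random vectors $\bm u_{i,t}$. *)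

(* Defs.v *)
From HB Require Import structures.
From mathcomp Require Import all_boot all_order all_algebra.
From mathcomp Require Import all_classical all_reals all_analysis.

Set Implicit Arguments.
Unset Strict Implicit.
Unset Printing Implicit Defensive.

Import Order.TTheory GRing.Theory Num.Theory.
Import numFieldNormedType.Exports.

Local Open Scope classical_set_scope.
Local Open Scope ring_scope.

Section Euclidean.
Context {R : realType} {d : nat}.
Implicit Types (x y : 'rV[R]_d) (K S : set 'rV[R]_d) (f w : 'rV[R]_d -> R).

Definition dotv x y : R := (x *m y^T) 0 0.

(* [`|x|] is the max norm of the row vector x, hence a separate definition. *)
Definition norm2 x : R := Num.sqrt (dotv x x).

Definition ball2 (r : R) : set 'rV[R]_d := [set x | norm2 x <= r].

Definition is_norm (N : 'rV[R]_d -> R) : Prop :=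
  [/\ forall x y, N (x + y) <= N x + N y,
      forall (a : R) x, N (a *: x) = `|a| * N x
    & forall x, N x = 0 -> x = 0].

Definition dual_norm (N : 'rV[R]_d -> R) x : R :=
  sup [set dotv x y | y in [set y | N y = 1]].

Definition grad f x : 'rV[R]_d := \row_k 'D_(delta_mx 0 k) f x.

Definition bregman w x y : R := w x - w y - dotv (grad w y) (x - y).

Definition is_argmin S f x : Prop := S x /\ forall y, S y -> f x <= f y.

Definition scale_set (a : R) S : set 'rV[R]_d := [set a *: x | x in S].

Definition lipschitz_wrt (N : 'rV[R]_d -> R) (G : R) K f : Prop :=
  forall x y, K x -> K y -> `|f x - f y| <= G * N (x - y).

End Euclidean.

Section Network.
Context {R : realType} {m : nat}.
Implicit Types (P : 'M[R]_m) (W : nat -> 'M[R]_m).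

Definition doubly_stochastic P : Prop :=
  [/\ forall i j, 0 <= P i j,
      forall i, \sum_j P i j = 1
    & forall j, \sum_i P i j = 1].

(* The edge set {{i, j} : P_ij > 0} consists of unordered pairs: {i, j} is in
   it as soon as one of P_ij and P_ji is positive. *)
Definition edge P : rel 'I_m := fun i j => (0 < P i j) || (0 < P j i).

(* Union of the edge sets of the rounds kB + 1, ..., (k + 1)B. *)
Definition block_edge W (B k : nat) : rel 'I_m :=
  fun i j => [exists s : 'I_B, edge (W (k * B + s.+1)%N) i j].

Definition network_assumption (zeta : R) (B : nat) W : Prop :=
  [/\ forall t, (1 <= t)%N -> doubly_stochastic (W t),
      forall t i, (1 <= t)%N -> zeta <= W t i i,
      forall t i j, (1 <= t)%N -> edge (W t) i j -> zeta <= W t i j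
    & forall k i j, connect (block_edge W B k) i j].

End Network.

Section DistanceGenerating.
Context {R : realType} {d : nat}.
Implicit Types (K : set 'rV[R]_d) (w N : 'rV[R]_d -> R).

Definition strongly_convex_smooth N (sigma G : R) K w : Prop :=
  [/\ forall x, K x -> differentiable w x,
      forall x y, K x -> K y ->
        w y + dotv (grad w y) (x - y) + sigma / 2 * N (x - y) ^+ 2 <= w x
    & forall x y, K x -> K y ->
        dual_norm N (grad w x - grad w y) <= G * N (x - y)].

Definition bregman_convex_right K w : Prop :=
  forall (x : 'rV[R]_d) (n : nat) (a : 'I_n -> R) (y : 'I_n -> 'rV[R]_d),
    K x -> (forall i, K (y i)) -> (forall i, 0 <= a i) -> \sum_i a i = 1 ->
    bregman w x (\sum_i a i *: y i) <= \sum_i a i * bregman w x (y i).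

End DistanceGenerating.

Section RandomVectors.
Context {R : realType} {d : nat} {disp : measure_display}
  {Om : measurableType disp} (Pr : probability Om R).

(* R^d with its Borel sigma-algebra. *)
Definition borelV := g_sigma_algebraType (@open 'rV[R]_d).

Definition random_vector (X : Om -> 'rV[R]_d) : Prop :=
  measurable_fun [set: Om] (X : Om -> borelV).

(* The uniform distribution on the unit sphere is the normalized Haar measure
   of the sphere, i.e. its only Borel probability measure that is invariant
   under the orthogonal group. *)
Definition uniform_on_sphere (U : Om -> 'rV[R]_d) : Prop :=
  [/\ random_vector U,
      forall w, norm2 (U w) = 1
    & forall (Q : 'M[R]_d) (A : set borelV), Q *m Q^T = 1%:M -> measurable A ->
        Pr ((fun w => U w *m Q) @^-1` A) = Pr (U @^-1` A)].

Definition independent_of (X : Om -> 'rV[R]_d) (F : set (set Om)) : Prop :=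
  forall (A : set borelV) (H : set Om), measurable A -> F H ->
    Pr (X @^-1` A `&` H) = (Pr (X @^-1` A) * Pr H)%E.

(* The sigma-algebra generated by the directions u_{j,s} and the approximate
   minimizers y_{j,s} of all nodes j in the rounds s < t. *)
Definition past (m : nat) (u y : 'I_m -> nat -> Om -> 'rV[R]_d) (t : nat) :
    set (set Om) :=
  <<s [set E | exists j s (A : set borelV),
         [/\ (1 <= s < t)%N, measurable A
           & E = u j s @^-1` A \/ E = y j s @^-1` A]] >>.

End RandomVectors.

Section Algorithm.
Context {R : realType} {d m : nat}.
Implicit Types (l : 'I_m -> nat -> 'rV[R]_d -> R) (r w : 'rV[R]_d -> R).

Definition two_point_grad (delta : R) (f : 'rV[R]_d -> R) (x u : 'rV[R]_d) :
    'rV[R]_d :=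
  (d%:R / (2 * delta) * (f (x + delta *: u) - f (x - delta *: u))) *: u.

Definition prox_objective (eta : R) r w (g xt x : 'rV[R]_d) : R :=
  dotv g x + r x + eta^-1 * bregman w x xt.

(* [BanODCMD_run] says that x, y, u are the iterates, the approximate minimizers
   and the random directions of one execution with horizon T. The choice of
   [y i t] among the rho_t-approximate minimizers is arbitrary (measurable, but
   possibly using additional randomness), except that later directions are
   independent of it. *)
Record BanODCMD_run (disp : measure_display) (Om : measurableType disp)
    (Pr : probability Om R) (K : set 'rV[R]_d) l r w (W : nat -> 'M[R]_m)
    (T : nat) (eta : R) (rho : nat -> R) (delta xi : R)
    (x y u : 'I_m -> nat -> Om -> 'rV[R]_d) : Prop := {
  run_init : forall i o, is_argmin (scale_set (1 - xi) K) w (x i 1 o) ;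
  run_dir : forall i t, (1 <= t <= T)%N -> uniform_on_sphere Pr (u i t) ;
  run_fresh : forall i t, (1 <= t <= T)%N ->
    independent_of Pr (u i t) (past u y t) ;
  run_meas : forall i t, (1 <= t <= T)%N -> random_vector (y i t) ;
  run_approx : forall i t o, (1 <= t <= T)%N ->
    let F := prox_objective eta r w
               (two_point_grad delta (l i t) (x i t o) (u i t o)) (x i t o) in
    scale_set (1 - xi) K (y i t o) /\
    exists2 ystar, is_argmin (scale_set (1 - xi) K) F ystar
                 & F (y i t o) <= F ystar + rho t ;
  run_mix : forall i t o, (1 <= t <= T)%N ->
    x i t.+1 o = \sum_j W t i j *: y j t o
}.

Definition total_loss l r (T : nat) (z : nat -> 'rV[R]_d) : R :=
  \sum_(1 <= t < T.+1) \sum_(j < m) (l j t (z t) + r (z t)).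

Definition avg_regret l r (T : nat) (z : nat -> 'rV[R]_d) (xstar : 'rV[R]_d) :
    R :=
  T%:R^-1 * total_loss l r T z - T%:R^-1 * total_loss l r T (fun=> xstar).

End Algorithm.

(* Main.v *)
Require Import Defs.
From HB Require Import structures.
From mathcomp Require Import all_boot all_order all_algebra.
From mathcomp Require Import all_classical all_reals all_analysis.
From mathcomp Require Import measurable_realfun.
From mathcomp Require Import zify ring lra.

Import Order.TTheory GRing.Theory Num.Theory.
Import numFieldNormedType.Exports.

Local Open Scope classical_set_scope.
Local Open Scope ring_scope.

(** The regret splits into a deterministic part, bounded along every trajectory,
    and the bias of the gradient estimators, bounded in expectation.

    The bias. The usual argument identifies the expected two-point estimator with
    the gradient of a ball average of the loss, by the divergence theorem. Here a
    reflection argument replaces it. Let [h] be the convex loss, [x] the query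
    point, [z] the comparator, [v = x - z], and let [c] be a lower bound of
    [h a - h (a - v)] at all query points [a]. Reflecting the random direction
    [u] in the hyperplane orthogonal to [v] moves the query points parallel to
    [v], and by convexity [h] has slope at least [c] along [v] there; so the
    estimators of [u] and of its mirror image add up to at least
    [2 c d <u, v>^2 / <v, v>] along [v] ([two_point_grad_mirror]). The uniform
    law on the sphere is invariant under the reflection and
    [E <u, v>^2 = <v, v> / d] ([sphere_second_moment]), so the expectation along
    [v] is at least [c] ([two_point_grad_mean]), and
    [c = h x - h z - O(delta)] is admissible as [h] is Lipschitz. The query point
    is itself random, but the direction is independent of the past: the joint
    law is a product and Tonelli's theorem allows the query point to be frozen
    ([integral_decoupling], [bandit_bias]).

    The trajectory. The estimators are bounded by a multiple of
    [pbar * pbar_dual * d], deterministically. The three-point inequality of the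
    proximal step, with its inexactness turned by strong convexity into a
    distance of order [sqrt (eta * rho t)], bounds the linearized regret of a
    round by a difference of Bregman divergences plus errors ([prox_regret]). The
    divergences telescope because averaging with doubly stochastic weights does
    not increase their sum ([bregman_telescope]). The proximal steps are short
    ([prox_drift]) and averaging over boundedly many rounds contracts the diameter
    of the states by a fixed factor, so that the nodes disagree by a multiple of
    the total step length ([consensus]). As [sqrt (rho t)] is of order
    [t ^ (-3/4)], whose sum up to [T] is of order [T ^ (1/4)] ([sum_root4V3]), all
    errors sum up to a multiple of [pbar * pbar_dual * d * sqrt T]
    ([pathwise_regret]).

    Shrinking [K] by [xi = delta / R_low] keeps the queries inside [K]
    ([scale_set_explore]) and displaces the comparator by [O(delta)] only. *)

Set Implicit Arguments.
Unset Strict Implicit.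
Unset Printing Implicit Defensive.

(** * Inner products, reflections and norms *)

Section InnerProduct.
Context {R : realType} {d : nat}.
Implicit Types (a b x y z v : 'rV[R]_d) (Q : 'M[R]_d).

Lemma dotvE x y : dotv x y = \sum_k x 0 k * y 0 k.
Proof. by rewrite /dotv mxE; apply: eq_bigr => k _; rewrite mxE. Qed.

Lemma dotvC x y : dotv x y = dotv y x.
Proof. by rewrite !dotvE; apply: eq_bigr => k _; rewrite mulrC. Qed.

Lemma dotvDl x y z : dotv (x + y) z = dotv x z + dotv y z.
Proof. by rewrite /dotv mulmxDl mxE. Qed.

Lemma dotvZl (c : R) x y : dotv (c *: x) y = c * dotv x y.
Proof. by rewrite /dotv -scalemxAl mxE. Qed.

Lemma dotvNl x y : dotv (- x) y = - dotv x y.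
Proof. by rewrite -scaleN1r dotvZl mulN1r. Qed.

Lemma dotvBl x y z : dotv (x - y) z = dotv x z - dotv y z.
Proof. by rewrite dotvDl dotvNl. Qed.

Lemma dotvDr x y z : dotv z (x + y) = dotv z x + dotv z y.
Proof. by rewrite dotvC dotvDl !(dotvC z). Qed.

Lemma dotvZr (c : R) x y : dotv x (c *: y) = c * dotv x y.
Proof. by rewrite dotvC dotvZl dotvC. Qed.

Lemma dotvNr x y : dotv x (- y) = - dotv x y.
Proof. by rewrite dotvC dotvNl dotvC. Qed.

Lemma dotvBr x y z : dotv z (x - y) = dotv z x - dotv z y.
Proof. by rewrite dotvDr dotvNr. Qed.

Lemma dotv0r x : dotv x 0 = 0.
Proof. by rewrite -[0 in LHS](subrr 0) dotvBr subrr. Qed.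

Lemma dotv_ge0 x : 0 <= dotv x x.
Proof. by rewrite dotvE sumr_ge0// => k _; rewrite -expr2 sqr_ge0. Qed.

Lemma dotv_eq0 x : (dotv x x == 0) = (x == 0).
Proof.
apply/eqP/eqP => [|->]; last exact: dotv0r.
rewrite dotvE => /eqP; rewrite psumr_eq0 => [/allP x0|k _]; last first.
  by rewrite -expr2 sqr_ge0.
apply/rowP => k; rewrite mxE; apply/eqP; rewrite -sqrf_eq0 expr2.
exact: x0 (mem_index_enum k).
Qed.

Lemma dotv_gt0 x : x != 0 -> 0 < dotv x x.
Proof. by rewrite lt0r dotv_eq0 dotv_ge0 andbT. Qed.

Lemma norm2_ge0 x : 0 <= norm2 x.
Proof. exact: sqrtr_ge0. Qed.

Lemma sqr_norm2 x : norm2 x ^+ 2 = dotv x x.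
Proof. by rewrite sqr_sqrtr ?dotv_ge0. Qed.

Lemma norm2Z (c : R) x : norm2 (c *: x) = `|c| * norm2 x.
Proof.
by rewrite /norm2 dotvZl dotvZr mulrA -expr2 sqrtrM ?sqr_ge0// sqrtr_sqr.
Qed.

Lemma norm2N x : norm2 (- x) = norm2 x.
Proof. by rewrite -scaleN1r norm2Z normrN1 mul1r. Qed.

Lemma norm2_delta (k : 'I_d) : norm2 (delta_mx 0 k : 'rV[R]_d) = 1.
Proof.
rewrite /norm2 dotvE (bigD1 k)//= big1 => [|i /negbTE ik]; last first.
  by rewrite !mxE ik andbF mul0r.
by rewrite !mxE !eqxx/= mulr1 addr0 sqrtr1.
Qed.

Lemma dotv_delta x (k : 'I_d) : dotv x (delta_mx 0 k) = x 0 k.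
Proof.
rewrite dotvE (bigD1 k)//= big1 => [|i /negbTE ik]; last first.
  by rewrite !mxE ik andbF mulr0.
by rewrite !mxE !eqxx/= mulr1 addr0.
Qed.

Definition householder a : 'M[R]_d := 1%:M - (2 / dotv a a) *: (a^T *m a).

Lemma mul_householder x a :
  x *m householder a = x - (2 / dotv a a * dotv x a) *: a.
Proof.
rewrite mulmxBr mulmx1 -scalemxAr mulmxA [x *m a^T]mx11_scalar mul_scalar_mx.
by rewrite scalerA.
Qed.

Lemma householder_orthogonal a : a != 0 ->
  householder a *m (householder a)^T = 1%:M.
Proof.
move=> a0; have aa0 : dotv a a != 0 by rewrite dotv_eq0.
have symQ : (householder a)^T = householder a.
  by rewrite /householder linearB linearZ/= trmx1 trmx_mul trmxK.
rewrite symQ; apply/row_matrixP => k.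
rewrite !rowE mulmx1 mulmxA !mul_householder dotvBl dotvZl -addrA -opprD -scalerDl.
rewrite [X in X *: a](_ : _ = 0) ?scale0r ?subr0//.
by field.
Qed.

(** Two distinct unit vectors are exchanged by the reflection across their
    bisecting hyperplane. *)
Lemma orthogonal_unit_transitive a b : norm2 a = 1 -> norm2 b = 1 ->
  exists2 Q : 'M[R]_d, Q *m Q^T = 1%:M & a *m Q = b.
Proof.
move=> a1 b1; have [->|ab] := eqVneq a b.
  by exists 1%:M; rewrite ?trmx1 ?mulmx1.
have ab0 : a - b != 0 by rewrite subr_eq0.
exists (householder (a - b)); first exact: householder_orthogonal.
have aa : dotv a a = 1 by rewrite -sqr_norm2 a1 expr1n.
have bb : dotv b b = 1 by rewrite -sqr_norm2 b1 expr1n.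
have ne0 : dotv (a - b) (a - b) != 0 by rewrite dotv_eq0.
rewrite mul_householder; move: ne0.
rewrite !dotvBl !dotvBr aa bb (dotvC b a) => ne0.
rewrite (_ : _ * _ = 1); last by field; apply: contra_neq ne0; lra.
by rewrite scale1r opprB addrC subrK.
Qed.

Lemma coord_le_mx_norm x (k : 'I_d) : `|x 0 k| <= `|x|.
Proof.
rewrite [leRHS]/Num.norm/= mx_normrE.
by apply/bigmax_geP; right; exists (ord0, k).
Qed.

Lemma dotv_mulmx x y Q : dotv (x *m Q) y = dotv x (y *m Q^T).
Proof. by rewrite /dotv trmx_mul trmxK mulmxA. Qed.

End InnerProduct.

Section Norms.
Context {R : realType} {d : nat} (N : 'rV[R]_d -> R).
Implicit Types (x y z v : 'rV[R]_d).
Context (hN : is_norm N).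

Lemma is_normD x y : N (x + y) <= N x + N y.
Proof. by have [+ _ _] := hN; apply. Qed.

Lemma is_normZ (c : R) x : N (c *: x) = `|c| * N x.
Proof. by have [_ + _] := hN; apply. Qed.

Lemma is_norm0 : N 0 = 0.
Proof. by rewrite -(scale0r 0) is_normZ normr0 mul0r. Qed.

Lemma is_normN x : N (- x) = N x.
Proof. by rewrite -scaleN1r is_normZ normrN1 mul1r. Qed.

Lemma is_normB x y : N (x - y) = N (y - x).
Proof. by rewrite -is_normN opprB. Qed.

Lemma is_norm_ge0 x : 0 <= N x.
Proof.
have := is_normD x (- x); rewrite subrr is_norm0 is_normN.
by rewrite -mulr2n pmulrn_lge0.
Qed.

Lemma is_norm_eq0 x : (N x == 0) = (x == 0).
Proof.
by apply/eqP/eqP => [|->]; [have [_ _ +] := hN; exact | exact: is_norm0].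
Qed.

Lemma is_norm_gt0 x : x != 0 -> 0 < N x.
Proof. by rewrite lt0r is_norm_eq0 is_norm_ge0 andbT. Qed.

Lemma is_norm_sum (I : Type) (s : seq I) (P : pred I) (F : I -> 'rV[R]_d) :
  N (\sum_(i <- s | P i) F i) <= \sum_(i <- s | P i) N (F i).
Proof.
elim/big_rec2: _ => [|i a b _ ab]; first by rewrite is_norm0.
by apply: le_trans (is_normD _ _) _; rewrite lerD2l.
Qed.

Lemma is_norm_lip x y : `|N x - N y| <= N (x - y).
Proof.
have h a b : N a - N b <= N (a - b).
  by rewrite lerBlDr -{1}[a](subrK b) is_normD.
by rewrite ler_norml h andbT lerNl opprB is_normB.
Qed.

Lemma is_norm_le_mx_norm : exists2 c, 0 < c & forall x, N x <= c * `|x|.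
Proof.
exists (1 + \sum_(k < d) N (delta_mx 0 k)).
  by rewrite ltr_pwDl// sumr_ge0// => k _; exact: is_norm_ge0.
move=> x; rewrite [in N x](matrix_sum_delta x) big_ord1.
apply: le_trans (is_norm_sum _ _ _) _.
apply: (@le_trans _ _ (\sum_(k < d) N (delta_mx 0 k) * `|x|)).
  apply: ler_sum => k _; rewrite is_normZ mulrC.
  apply: ler_wpM2l; first exact: is_norm_ge0.
  exact: coord_le_mx_norm.
by rewrite -mulr_suml ler_wpM2r// lerDr.
Qed.

(** The unit sphere of the maximum norm is compact, and [N] is continuous and
    does not vanish on it. *)
Lemma mx_norm_le_is_norm : exists2 c, 0 < c & forall x, `|x| <= c * N x.
Proof.
have [M M0 NM] := is_norm_le_mx_norm.
have cN : continuous N.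
  move=> x; apply/(@cvgrPdist_lt _ _ _ (nbhs x)) => e e0; near=> y.
  apply: le_lt_trans (is_norm_lip _ _) _; apply: le_lt_trans (NM _) _.
  rewrite -ltr_pdivlMl// mulrC; near: y.
  by apply: (@cvgr_dist_lt _ _ _ (nbhs x)) => //; rewrite divr_gt0.
pose S : set 'rV[R]_d := [set x | `|x| = 1].
have [[x0 Sx0]|S0] := pselect (exists x, S x); last first.
  exists 1 => // x; have [->|x0] := eqVneq x 0; first by rewrite normr0 is_norm0 mulr0.
  exfalso; apply: S0; exists (`|x|^-1 *: x); rewrite /S/= normrZ normfV normr_id.
  by rewrite mulVf// normr_eq0.
have cS : compact S.
  apply: bounded_closed_compact.
    by exists 1; split; [exact: num_real | move=> t t1 x /= ->; exact: ltW].
  rewrite (_ : S = Num.norm @^-1` [set 1 : R])//.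
  apply: preimage_closed => [x _|]; last exact: closed_eq.
  exact: norm_continuous.
have [||c + cmin] := @compact_EVT_min _ _ N S _ cS.
- by exists x0.
- exact: continuous_subspaceT.
rewrite inE => Sc; have Nc : 0 < N c.
  by apply: is_norm_gt0; apply: contra_eq_neq Sc => ->; rewrite normr0 eq_sym oner_neq0.
exists (N c)^-1; first by rewrite invr_gt0.
move=> x; have [->|x0'] := eqVneq x 0; first by rewrite normr0 is_norm0 mulr0.
have nx0 : 0 < `|x| by rewrite normr_gt0.
rewrite mulrC ler_pdivlMr// mulrC -ler_pdivlMr//.
have /cmin : (`|x|^-1 *: x) \in S.
  by rewrite inE /S/= normrZ normfV normr_id mulVf// gt_eqF.
by rewrite is_normZ normfV normr_id mulrC.
Unshelve. all: by end_near. Qed.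

(** The supremum that defines the dual norm is over a bounded set, since [N]
    dominates a multiple of the maximum norm; hence it is an upper bound. *)
Lemma dotv_le_dual x y : dotv x y <= dual_norm N x * N y.
Proof.
have [->|y0] := eqVneq y 0.
  by rewrite dotv0r is_norm0 mulr0.
have Ny0 := is_norm_gt0 y0.
rewrite -ler_pdivrMr// mulrC -dotvZr; apply: ub_le_sup; last first.
  by exists ((N y)^-1 *: y) => //=; rewrite is_normZ normfV ger0_norm ?mulVf ?gt_eqF// ltW.
have [c c0 Hc] := mx_norm_le_is_norm.
exists (\sum_(k < d) `|x| * c) => _ [z /= Nz <-].
rewrite dotvE; apply: ler_sum => k _; apply: le_trans (ler_norm _) _.
rewrite normrM; apply: ler_pM => //; first exact: coord_le_mx_norm.
by apply: le_trans (coord_le_mx_norm _ _) _; apply: le_trans (Hc _) _; rewrite Nz mulr1.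
Qed.

(** With [`|G|] instead of [G], the bound is monotone in [N (x - y)] whatever
    the sign of [G]. *)
Lemma lipschitz_wrt_norm (K : set 'rV[R]_d) (G : R) (f : 'rV[R]_d -> R) x y :
  lipschitz_wrt N G K f -> K x -> K y -> `|f x - f y| <= `|G| * N (x - y).
Proof.
move=> fG Kx Ky; apply: le_trans (fG _ _ Kx Ky) _.
by apply: ler_wpM2r; [exact: is_norm_ge0|exact: ler_norm].
Qed.

Lemma lipschitz_wrt_le (K : set 'rV[R]_d) (G : R) (f : 'rV[R]_d -> R) x y :
  lipschitz_wrt N G K f -> K x -> K y -> f x - f y <= `|G| * N (x - y).
Proof.
by move=> fG Kx Ky; exact: le_trans (ler_norm _) (lipschitz_wrt_norm fG Kx Ky).
Qed.

End Norms.

(** * Convexity and the mirrored two-point estimator *)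

Section Convexity.
Context {R : realType} {d : nat}.
Implicit Types (x y z a b v u : 'rV[R]_d) (h : 'rV[R]_d -> R).

Lemma convex_setP (K : set 'rV[R]_d) (c : R) x y :
  @convex_set R 'rV[R]_d K -> K x -> K y -> 0 <= c <= 1 ->
  K (c *: x + (1 - c) *: y).
Proof.
move=> cK Kx Ky /andP[c0 c1].
by have := cK x y (Itv01 c0 c1); rewrite !inE; exact.
Qed.

Lemma convex_functionP h (c : R) x y :
  @convex_function R 'rV[R]_d [set: 'rV[R]_d] h -> 0 <= c <= 1 ->
  h (c *: x + (1 - c) *: y) <= c * h x + (1 - c) * h y.
Proof.
move=> ch /andP[c0 c1].
by have := ch (Itv01 c0 c1) x y; rewrite !inE; exact.
Qed.

Lemma convex_set_sum (K : set 'rV[R]_d) n (c : 'I_n -> R)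
    (f : 'I_n -> 'rV[R]_d) :
  @convex_set R 'rV[R]_d K -> (forall i, 0 <= c i) -> \sum_i c i = 1 ->
  (forall i, K (f i)) -> K (\sum_i c i *: f i).
Proof.
move=> cK; elim: n c f => [|n IH] c f c0 c1 Kf.
  by move: c1; rewrite big_ord0 => /eqP; rewrite eq_sym oner_eq0.
rewrite big_ord_recl; set s := \sum_(i < n) c (lift ord0 i).
have cs : c ord0 = 1 - s by rewrite -c1 big_ord_recl addrK.
have s0 : 0 <= s by rewrite sumr_ge0.
have [s00|sn0] := eqVneq s 0.
  rewrite big1 => [|i _]; first by rewrite cs s00 subr0 scale1r addr0.
  have /eqP := s00; rewrite psumr_eq0// => /allP/(_ i (mem_index_enum i)).
  by move=> /eqP ->; rewrite scale0r.
have := IH (fun i => s^-1 * c (lift ord0 i)) (fun i => f (lift ord0 i)).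
rewrite -mulr_sumr mulVf// => Ks.
rewrite (_ : \sum_(i < n) _ =
    s *: (\sum_i (s^-1 * c (lift ord0 i)) *: f (lift ord0 i))); last first.
  rewrite scaler_sumr; apply: eq_bigr => i _.
  by rewrite scalerA mulrA divff// mul1r.
rewrite [X in _ + X *: _](_ : s = 1 - c ord0); last first.
  by rewrite cs opprB addrC subrK.
apply: (convex_setP cK); [exact: Kf| |by rewrite c0 cs gerBl].
by apply: Ks => [i||i]; rewrite ?mulr_ge0 ?invr_ge0.
Qed.

(** Slopes of a convex function increase along a line, here through the
    points [a - v], [a] and [a + tau v]. *)
Lemma convex_slope h a v (tau : R) :
  @convex_function R 'rV[R]_d [set: 'rV[R]_d] h -> 0 <= tau ->
  tau * (h a - h (a - v)) <= h (a + tau *: v) - h a.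
Proof.
move=> ch tau0; have t1 : 0 < 1 + tau by rewrite ltr_pwDl.
have := @convex_functionP h (1 + tau)^-1 (a + tau *: v) (a - v) ch.
rewrite invr_ge0 (ltW t1) invf_le1// lerDl tau0 => /(_ isT).
have -> : 1 - (1 + tau)^-1 = tau / (1 + tau) by field; rewrite gt_eqF.
have -> : (1 + tau)^-1 *: (a + tau *: v) + (tau / (1 + tau)) *: (a - v) = a.
  rewrite scalerDr scalerBr scalerA mulrC addrACA subrr addr0 -scalerDl.
  by rewrite (_ : _ + _ = 1) ?scale1r//; field; rewrite gt_eqF.
rewrite [_ / _]mulrC -mulrA -mulrDr mulrC ler_pdivlMr//; lra.
Qed.

Lemma convex_slope_sqr h a v (c tau : R) :
  @convex_function R 'rV[R]_d [set: 'rV[R]_d] h ->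
  c <= h a - h (a - v) -> c <= h (a + tau *: v) - h (a + tau *: v - v) ->
  c * tau ^+ 2 <= tau * (h (a + tau *: v) - h a).
Proof.
move=> ch ca cb; have [tau0|tau0] := leP 0 tau.
  have := convex_slope a v ch tau0; nra.
have := @convex_slope h (a + tau *: v) v (- tau) ch.
rewrite oppr_ge0 (ltW tau0) => /(_ isT).
by rewrite scaleNr addrK; nra.
Qed.

(** The heart of the bandit analysis. Reflecting the direction [u] in the
    hyperplane orthogonal to [v] moves both query points parallel to [v], and
    the slope of [h] along [v] is at least [c] at all of them; hence the
    estimators of [u] and of its mirror image together see this slope. *)
Lemma two_point_grad_mirror (delta c : R) h x v u :
  @convex_function R 'rV[R]_d [set: 'rV[R]_d] h -> 0 < delta -> v != 0 ->
  (forall e, norm2 e = 1 -> c <= h (x + delta *: e) - h (x + delta *: e - v)) ->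
  norm2 u = 1 ->
  2 * c * d%:R * (dotv u v ^+ 2 / dotv v v) <=
  dotv (two_point_grad delta h x u) v +
  dotv (two_point_grad delta h x (u *m householder v)) v.
Proof.
move=> ch delta0 v0 hc u1; have vv := dotv_gt0 v0.
set s := dotv u v; set u' := u *m householder v.
have u'E : u' = u - (2 / dotv v v * s) *: v by rewrite /u' mul_householder.
have uE : u = u' + (2 / dotv v v * s) *: v by rewrite u'E subrK.
have u'1 : norm2 u' = 1.
  rewrite -u1 /norm2; congr Num.sqrt.
  by rewrite dotv_mulmx /u' -mulmxA householder_orthogonal// mulmx1.
have u'v : dotv u' v = - s.
  by rewrite u'E dotvBl dotvZl -/s; field; rewrite gt_eqF.
have N1 (e : 'rV[R]_d) : norm2 e = 1 -> norm2 (- e) = 1.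
  by rewrite -scaleN1r norm2Z normrN1 mul1r.
set k := 2 / dotv v v in uE; have k0 : 0 < k by rewrite divr_gt0.
have pair1 : c * (delta * k * s ^+ 2) <=
    s * (h (x + delta *: u) - h (x + delta *: u')).
  have xu : x + delta *: u = x + delta *: u' + (delta * k * s) *: v.
    by rewrite [in LHS]uE scalerDr scalerA addrA mulrA.
  have := @convex_slope_sqr h (x + delta *: u') v c (delta * k * s) ch.
  rewrite -xu => /(_ (hc _ u'1) (hc _ u1)) H.
  rewrite -(ler_pM2l (mulr_gt0 delta0 k0)).
  lra.
have pair2 : c * (delta * k * s ^+ 2) <=
    s * (h (x - delta *: u') - h (x - delta *: u)).
  have xu : x - delta *: u' = x - delta *: u + (delta * k * s) *: v.
    by rewrite [in RHS]uE scalerDr scalerA opprD addrA mulrA subrK.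
  have := @convex_slope_sqr h (x - delta *: u) v c (delta * k * s) ch.
  rewrite -xu -!scalerN => /(_ (hc _ (N1 _ u1)) (hc _ (N1 _ u'1))) H.
  rewrite -(ler_pM2l (mulr_gt0 delta0 k0)).
  lra.
rewrite /two_point_grad !dotvZl u'v -/s.
have -> : 2 * c * d%:R * (s ^+ 2 / dotv v v) =
    d%:R / (2 * delta) * (2 * (c * (delta * k * s ^+ 2))).
  by rewrite /k; field; rewrite !gt_eqF.
have D0 : 0 <= d%:R / (2 * delta) by rewrite divr_ge0// mulr_ge0// ltW.
have := ler_wpM2l D0 pair1; have := ler_wpM2l D0 pair2; lra.
Qed.

End Convexity.

(** * Inexact proximal steps *)

Section MirrorDescent.
Context {R : realType} {d : nat}.
Context (N r w : 'rV[R]_d -> R) (K S : set 'rV[R]_d) (sigma Gw Gr eta : R).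
Context (hN : is_norm N) (hw : strongly_convex_smooth N sigma Gw K w).
Context (hr : @convex_function R 'rV[R]_d [set: 'rV[R]_d] r).
Context (hrL : lipschitz_wrt N Gr K r).
Context (cS : @convex_set R 'rV[R]_d S) (SK : S `<=` K).
Context (sigma0 : 0 < sigma) (eta0 : 0 < eta).
Implicit Types (x y z g : 'rV[R]_d).

Lemma bregman_ge x y : K x -> K y -> sigma / 2 * N (x - y) ^+ 2 <= bregman w x y.
Proof. by have [_ + _] := hw => /(_ x y) h Kx Ky; have := h Kx Ky; rewrite /bregman; lra. Qed.

Lemma bregman_ge0 x y : K x -> K y -> 0 <= bregman w x y.
Proof.
by move=> Kx Ky; apply: le_trans (bregman_ge Kx Ky); rewrite mulr_ge0 ?sqr_ge0 ?divr_ge0 ?ltW.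
Qed.

Lemma grad_smooth x y b : K x -> K y ->
  dotv (grad w x - grad w y) b <= `|Gw| * N (x - y) * N b.
Proof.
move=> Kx Ky; apply: le_trans (dotv_le_dual hN _ _) _.
apply: ler_wpM2r; first exact: is_norm_ge0.
have [_ _ +] := hw => /(_ x y Kx Ky) /le_trans; apply.
by apply: ler_wpM2r; [exact: is_norm_ge0|exact: ler_norm].
Qed.

(** [bregman w x y] and [bregman w y x] are nonnegative and add up to the
    pairing of the gradient difference with [x - y]. *)
Lemma bregman_le x y : K x -> K y -> bregman w x y <= `|Gw| * N (x - y) ^+ 2.
Proof.
move=> Kx Ky; have := bregman_ge0 Ky Kx; have := grad_smooth (x - y) Kx Ky.
by rewrite dotvBl /bregman -[y - x]opprB dotvNr expr2; lra.
Qed.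

(** The first-order condition at [ys], without any derivative: on the segment
    from [ys] towards [z], the increment of [w] up to the parameter [c] is at
    most [c] times its slope at the far end, and this slope differs from the
    one at [ys] by a multiple of [c] because the gradient is Lipschitz. *)
Lemma prox_three_point g x ys z : S x ->
  is_argmin S (prox_objective eta r w g x) ys -> S z ->
  prox_objective eta r w g x ys + eta^-1 * bregman w z ys <=
  prox_objective eta r w g x z.
Proof.
move=> Sx [Sys minys] Sz.
pose A := dotv g (z - ys) + r z - r ys
  + eta^-1 * dotv (grad w ys - grad w x) (z - ys).
suff A0 : 0 <= A.
  rewrite -subr_ge0 (_ : _ - _ = A)//.
  rewrite /A /prox_objective /bregman !dotvBl !dotvBr; ring.
pose M := eta^-1 * (`|Gw| * N (z - ys) ^+ 2).
have M0 : 0 <= M by apply: mulr_ge0; [rewrite invr_ge0 ltW|rewrite mulr_ge0 ?sqr_ge0].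
have key (c : R) : 0 < c < 1 -> 0 <= A + c * M.
  move=> /andP[c0 c1]; pose yc : 'rV[R]_d := c *: z + (1 - c) *: ys.
  have c01 : 0 <= c <= 1 by rewrite !ltW.
  have Sc : S yc by exact: convex_setP.
  have ycE : yc - ys = c *: (z - ys).
    by rewrite /yc scalerBl scale1r scalerBr addrA addrAC addrK.
  have := minys _ Sc.
  have := convex_functionP z ys hr c01; rewrite -/yc.
  have wc : w yc - w ys <= c * (dotv (grad w ys) (z - ys) + `|Gw| * c * N (z - ys) ^+ 2).
    have := bregman_ge0 (SK Sys) (SK Sc); rewrite /bregman -[ys - yc]opprB dotvNr ycE.
    have := grad_smooth (z - ys) (SK Sc) (SK Sys).
    rewrite ycE (is_normZ hN) (gtr0_norm c0) dotvBl dotvZr => h1 h2.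
    suff : c * dotv (grad w yc) (z - ys) <=
        c * (dotv (grad w ys) (z - ys) + `|Gw| * c * N (z - ys) ^+ 2) by lra.
    by apply: ler_wpM2l; [exact: ltW | lra].
  rewrite /prox_objective /bregman.
  have -> : yc - x = (ys - x) + c *: (z - ys) by rewrite -ycE [RHS]addrC subrKA.
  have -> : dotv g yc = dotv g ys + c * dotv g (z - ys).
    by rewrite -dotvZr -ycE -dotvDr [in RHS]addrC subrK.
  have -> : dotv (grad w x) (ys - x + c *: (z - ys)) =
      dotv (grad w x) (ys - x) + c * dotv (grad w x) (z - ys).
    by rewrite dotvDr dotvZr.
  move=> h1 h2.
  have h3 : eta^-1 * (w yc - w ys) <= eta^-1 *
      (c * (dotv (grad w ys) (z - ys) + `|Gw| * c * N (z - ys) ^+ 2)).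
    by apply: ler_wpM2l => //; rewrite invr_ge0 ltW.
  rewrite -(pmulr_rge0 _ c0) /A /M dotvBl; lra.
rewrite leNgt; apply/negP => A0.
(* A negative [A] contradicts [key] for a small enough [c]. *)
have M1 : 0 < M + 1 by rewrite ltr_wpDl.
pose c := Num.min (1 / 2) (- A / 2 / (M + 1)).
have c0 : 0 < c by rewrite lt_min !divr_gt0// oppr_gt0.
have c12 : c <= 1 / 2 by rewrite ge_min lexx.
have cA : c <= - A / 2 / (M + 1) by rewrite ge_min lexx orbT.
have /key : 0 < c < 1 by rewrite c0/=; apply: le_lt_trans c12 _; lra.
move: cA; rewrite ler_pdivlMr//; nra.
Qed.

Context (x y g z : 'rV[R]_d) (rho e Gam D : R).
Context (Sx : S x) (Sy : S y) (Sz : S z).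
Context (hy : exists2 ys, is_argmin S (prox_objective eta r w g x) ys
  & prox_objective eta r w g x y <= prox_objective eta r w g x ys + rho).
Context (e0 : 0 <= e) (he : 2 * eta * rho / sigma <= e ^+ 2).
Context (hg : forall b, dotv g b + `|Gr| * N b <= Gam * N b).

(** Strong convexity turns the [rho]-suboptimality of [y] into a distance of
    order [sqrt (eta * rho)] to the exact minimizer. *)
Lemma prox_dist ys : is_argmin S (prox_objective eta r w g x) ys ->
  prox_objective eta r w g x y <= prox_objective eta r w g x ys + rho ->
  N (y - ys) <= e.
Proof.
move=> mys hrho; have Sys := mys.1.
have := prox_three_point Sx mys Sy => h.
have : eta^-1 * bregman w y ys <= rho by lra.
rewrite mulrC ler_pdivrMr// => h1.
have := bregman_ge (SK Sy) (SK Sys) => h2.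
rewrite -(@ler_pXn2r _ 2)// ?nnegrE ?is_norm_ge0//.
apply: le_trans he; rewrite ler_pdivlMr//; lra.
Qed.

(** The three-point inequality at [ys], moved to [y] at the cost of the distance
    [e]; the term [bregman w y x] absorbs the cost, of slope [Gam], of the passage
    from [y] to [x]. *)
Lemma prox_regret : N (z - y) <= D ->
  dotv g (x - z) + r x - r z <=
  eta^-1 * (bregman w z x - bregman w z y) + eta^-1 * (`|Gw| * e * D)
  + rho + eta / (2 * sigma) * Gam ^+ 2.
Proof.
move=> zD; have [ys mys hrho] := hy; have Sys := mys.1.
have yse := prox_dist mys hrho.
have h3 := prox_three_point Sx mys Sz.
have h4 : bregman w z y <= bregman w z ys + `|Gw| * e * D.
  have := grad_smooth (z - y) (SK Sys) (SK Sy).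
  have := bregman_ge0 (SK Sy) (SK Sys).
  have -> : bregman w z y = bregman w z ys - bregman w y ys
      + dotv (grad w ys - grad w y) (z - y).
    by rewrite /bregman !dotvBl !dotvBr; ring.
  suff : `|Gw| * N (ys - y) * N (z - y) <= `|Gw| * e * D by lra.
  apply: ler_pM => //; first by rewrite mulr_ge0// is_norm_ge0.
    exact: is_norm_ge0.
  by apply: ler_wpM2l => //; rewrite is_normB.
have h5 : eta^-1 * bregman w z y <= eta^-1 * bregman w z ys + eta^-1 * (`|Gw| * e * D).
  by rewrite -mulrDr ler_wpM2l// invr_ge0 ltW.
have h6 := bregman_ge (SK Sy) (SK Sx).
have h7 : eta^-1 * (sigma / 2 * N (y - x) ^+ 2) <= eta^-1 * bregman w y x.
  by rewrite ler_wpM2l// invr_ge0 ltW.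
have h8 := lipschitz_wrt_le hN hrL (SK Sx) (SK Sy).
have h9 := hg (x - y).
have h10 : Gam * N (x - y) <= eta^-1 * (sigma / 2 * N (y - x) ^+ 2)
    + eta / (2 * sigma) * Gam ^+ 2.
  rewrite (is_normB hN y x) -subr_ge0.
  have -> : eta^-1 * (sigma / 2 * N (x - y) ^+ 2) + eta / (2 * sigma) * Gam ^+ 2
      - Gam * N (x - y) = (2 * eta * sigma)^-1 * (sigma * N (x - y) - eta * Gam) ^+ 2.
    by field; rewrite !gt_eqF.
  by rewrite mulr_ge0 ?sqr_ge0// invr_ge0 !mulr_ge0// ltW.
move: h3 hrho h9; rewrite /prox_objective !dotvBr; lra.
Qed.

(** [y] is not worse than [x] up to [rho], so [bregman w y x], which grows
    quadratically, is paid for by terms of slope at most [Gam]. *)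
Lemma prox_drift : 0 <= Gam -> N (y - x) <= 2 * eta * Gam / sigma + e.
Proof.
move=> Gam0; have [ys mys hrho] := hy; have Sys := mys.1.
have := mys.2 _ Sx; rewrite /prox_objective.
have -> : bregman w x x = 0 by rewrite /bregman !subrr dotv0r subrr.
rewrite mulr0 addr0 => h1.
have h6 := bregman_ge (SK Sy) (SK Sx).
have h7 : eta^-1 * (sigma / 2 * N (y - x) ^+ 2) <= eta^-1 * bregman w y x.
  by rewrite ler_wpM2l// invr_ge0 ltW.
have h8 := lipschitz_wrt_le hN hrL (SK Sx) (SK Sy).
have h9 := hg (x - y).
have h10 : eta^-1 * (sigma / 2 * N (y - x) ^+ 2) <= Gam * N (y - x) + rho.
  move: hrho h8 h9; rewrite /prox_objective dotvBr (is_normB hN x y); lra.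
have h11 : N (y - x) ^+ 2 <= 2 * eta * Gam / sigma * N (y - x) + e ^+ 2.
  move: h10; rewrite mulrC ler_pdivrMr// => h10.
  have : N (y - x) ^+ 2 <= 2 * eta * Gam / sigma * N (y - x) + 2 * eta * rho / sigma.
    rewrite -(ler_pM2l sigma0) mulrDr.
    have -> : sigma * (2 * eta * Gam / sigma * N (y - x)) = 2 * eta * Gam * N (y - x).
      by field; rewrite gt_eqF.
    have -> : sigma * (2 * eta * rho / sigma) = 2 * eta * rho.
      by field; rewrite gt_eqF.
    lra.
  move: he; lra.
have a0 : 0 <= 2 * eta * Gam / sigma by rewrite divr_ge0 ?mulr_ge0// ltW.
move: h11 a0 (is_norm_ge0 hN (y - x)); move: (N _) (2 * _ * _ / _) => n a h11 a0 n0.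
rewrite leNgt; apply/negP => h12.
have e0' := e0; have : 0 < (n - (a + e)) * n by apply: mulr_gt0; lra.
have : 0 <= (n - e) * e by rewrite mulr_ge0// subr_ge0; lra.
nra.
Qed.

End MirrorDescent.

(** * Consensus over a time-varying network *)

Section Mixing.
Context {R : realType} {m : nat} (W : nat -> 'M[R]_m) (B : nat) (zeta : R).
Context (B0 : (0 < B)%N) (zeta0 : 0 < zeta) (hW : network_assumption zeta B W).
Implicit Types (s n t : nat) (i j k : 'I_m).

(** The weights after [n] rounds of pure averaging that start with round [s]. *)
Fixpoint transition s n : 'M[R]_m :=
  if n is n'.+1 then W (s + n') *m transition s n' else 1%:M.

Lemma mixing_ge0 t i j : (0 < t)%N -> 0 <= W t i j.
Proof. by have [h _ _ _] := hW => /h[]. Qed.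

Lemma mixing_row t i : (0 < t)%N -> \sum_j W t i j = 1.
Proof. by have [h _ _ _] := hW => /h[]. Qed.

Lemma mixing_col t j : (0 < t)%N -> \sum_i W t i j = 1.
Proof. by have [h _ _ _] := hW => /h[]. Qed.

Lemma zeta_le1 (i : 'I_m) : zeta <= 1.
Proof.
have [_ h _ _] := hW; apply: le_trans (h 1%N i isT) _.
by rewrite -(mixing_row i (ltn0Sn 0)) (bigD1 i)//= lerDl sumr_ge0// => j _; rewrite mixing_ge0.
Qed.

Lemma transition_ge0 s n i k : (0 < s)%N -> 0 <= transition s n i k.
Proof.
move=> s0; elim: n i => [|n IH] i /=; first by rewrite mxE ler0n.
by rewrite mxE sumr_ge0// => j _; rewrite mulr_ge0// mixing_ge0// addn_gt0 s0.
Qed.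

Lemma transition_row s n i : (0 < s)%N -> \sum_k transition s n i k = 1.
Proof.
move=> s0; elim: n i => [|n IH] i /=.
  rewrite (bigD1 i)//= big1 ?mxE ?eqxx ?addr0// => j /negbTE ji.
  by rewrite mxE eq_sym ji.
under eq_bigr do rewrite mxE.
rewrite exchange_big/= -[RHS](@mixing_row (s + n) i) ?addn_gt0 ?s0//.
by apply: eq_bigr => j _; rewrite -mulr_sumr IH mulr1.
Qed.

(** Every averaging step costs at most a factor [zeta]. *)
Definition reached s k n : {set 'I_m} :=
  [set i | zeta ^+ n <= transition s n i k].

Lemma reached_step s k n i j : (0 < s)%N -> zeta <= W (s + n) i j ->
  j \in reached s k n -> i \in reached s k n.+1.
Proof.
move=> s0 ij; rewrite !inE/= mxE (bigD1 j)//= exprS => jk.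
have sn0 : (0 < s + n)%N by rewrite addn_gt0 s0.
rewrite -[X in X <= _]addr0; apply: lerD.
  by apply: ler_pM => //; [exact: ltW | rewrite exprn_ge0// ltW].
by rewrite sumr_ge0// => l _; rewrite mulr_ge0 ?mixing_ge0 ?transition_ge0.
Qed.

Lemma reached_mono s k n n' : (0 < s)%N -> (n <= n')%N ->
  reached s k n \subset reached s k n'.
Proof.
move=> s0 /subnK <-; move: (n' - n)%N => p.
elim: p => [|p IH]; first by rewrite add0n.
apply: (fintype.subset_trans IH); apply/fintype.subsetP => i; apply: reached_step => //.
by have [_ h _ _] := hW; rewrite h// addn_gt0 s0.
Qed.

Lemma connect_closed_backward (T : finType) (e : rel T) (A : {set T}) (a b : T) :
  (forall c c' : T, e c c' -> c' \in A -> c \in A) -> connect e a b -> b \in A ->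
  a \in A.
Proof.
move=> eA /connectP[p ap ->] {b}; elim: p a ap => [//|c p IH] a /= /andP[ac cp] bA.
by apply: eA ac _; exact: IH.
Qed.

(** If the reached set did not grow during a whole block, no edge of the block
    would enter it, against connectedness. *)
Lemma reached_grows s k n b : (0 < s)%N -> (s + n = (b * B).+1)%N ->
  k \in reached s k n -> reached s k n != [set: 'I_m]%SET ->
  (#|reached s k n| < #|reached s k (n + B)|)%N.
Proof.
move=> s0 snb kn nT; apply: fintype.proper_card; rewrite finset.properEneq.
rewrite reached_mono ?leq_addr// andbT; apply: contra_neq nT => nB.
apply/finset.setP => i; rewrite [RHS]finset.in_setT.
have [_ _ hedge /(_ b i k) ik] := hW.
apply: connect_closed_backward ik kn => a c /existsP[[p pB]]/=.
rewrite addnS -addSn -snb -addnA => ac cn.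
rewrite {}nB; have /fintype.subsetP : reached s k (n + p).+1 \subset reached s k (n + B).
  by apply: reached_mono; rewrite // ltn_add2l.
apply; apply: (@reached_step _ _ _ _ c) => //; first by apply: hedge; rewrite ?addn_gt0 ?s0.
by apply: (fintype.subsetP (reached_mono _ s0 (leq_addr p n))).
Qed.

(** The set of nodes reached from [k] grows in every full block until it
    contains all [m] nodes, and [m + 1] block lengths contain [m] full blocks
    wherever they start. *)
Lemma transition_ge s i k : (0 < s)%N ->
  zeta ^+ (m.+1 * B) <= transition s (m.+1 * B) i k.
Proof.
move=> s0.
pose b := ((s.-1 + B.-1) %/ B)%N.
have bB : (s.-1 <= b * B)%N.
  have := divn_eq (s.-1 + B.-1) B; have := ltn_pmod (s.-1 + B.-1) B0.
  rewrite -/b; move: (_ %% _)%N => z; lia.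
have bB' : (b * B <= s.-1 + B.-1)%N by exact: leq_divM.
pose n0 := ((b * B).+1 - s)%N.
have sn0 : (s + n0 = (b * B).+1)%N by rewrite /n0; lia.
(* The first full block starts [n0] rounds after [s]. *)
have n0B : (n0 < B)%N by rewrite /n0; lia.
have k0 : k \in reached s k 0 by rewrite inE mxE eqxx expr0.
have kn n : k \in reached s k n by apply: (fintype.subsetP (reached_mono _ s0 (leq0n n))).
have stay q : reached s k (n0 + q * B) = finset.setT ->
    reached s k (n0 + q.+1 * B) = finset.setT.
  move=> qT; apply/eqP; rewrite -finset.subTset -qT; apply: reached_mono => //.
  by rewrite mulSn leq_add2l leq_addl.
have grow q : reached s k (n0 + q * B) = [set: 'I_m]%SET \/
    (q < #|reached s k (n0 + q * B)|)%N.
  elim: q => [|q [IH|IH]].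
  - by right; rewrite addn0; apply/card_gt0P; exists k.
  - left; exact: stay.
  - have [qT|nT] := eqVneq (reached s k (n0 + q * B)) finset.setT.
      by left; exact: stay.
    right; apply: leq_ltn_trans IH _.
    have := @reached_grows s k (n0 + q * B) (b + q) s0.
    by rewrite addnA sn0 mulnDl addSn => /(_ erefl (kn _) nT); rewrite -addnA -mulSnr.
have : i \in reached s k (n0 + m * B).
  case: (grow m) => [->|]; first by rewrite finset.in_setT.
  by rewrite ltnNge -[X in (_ <= X)%N]card_ord max_card.
move/(fintype.subsetP (reached_mono k s0 (_ : n0 + m * B <= m.+1 * B)%N)).
by rewrite inE; apply; rewrite mulSn leq_add2r ltnW.
Qed.

End Mixing.

Section Contraction.
Context {R : realType} {d m : nat} (N : 'rV[R]_d -> R) (hN : is_norm N).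

(** Remove the mass [alpha] that both combinations put on the point [k]: two
    combinations of mass [1 - alpha] remain, and their difference is an average
    of differences [X i - X j] over all pairs. *)
Lemma convex_combination_contraction (a b : 'I_m -> R) (X : 'I_m -> 'rV[R]_d)
    (alpha D : R) (k : 'I_m) :
  (forall i, 0 <= a i) -> (forall i, 0 <= b i) ->
  \sum_i a i = 1 -> \sum_i b i = 1 -> alpha <= a k -> alpha <= b k ->
  0 <= alpha -> 0 <= D -> (forall i j, N (X i - X j) <= D) ->
  N (\sum_i a i *: X i - \sum_i b i *: X i) <= (1 - alpha) * D.
Proof.
move=> a0 b0 a1 b1 ak bk al0 D0 XD.
pose c (f : 'I_m -> R) i := f i - (if i == k then alpha else 0).
have c0 f : (forall i, 0 <= f i) -> alpha <= f k -> forall i, 0 <= c f i.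
  move=> f0 fk i; rewrite /c; case: eqP => [->|_]; by rewrite subr_ge0.
have c1 f : \sum_i f i = 1 -> \sum_i c f i = 1 - alpha.
  move=> f1; rewrite /c big_split/= f1 sumrN; congr (_ - _).
  by rewrite -big_mkcond/= big_pred1_eq.
have cX f : \sum_i f i *: X i = \sum_i c f i *: X i + alpha *: X k.
  rewrite /c; under [in RHS]eq_bigr do rewrite scalerBl.
  rewrite big_split/= sumrN -addrA [X in _ + X](_ : _ = 0) ?addr0//.
  rewrite (bigD1 k)//= eqxx big1 ?addr0 ?addNr// => i /negbTE ->.
  by rewrite scale0r.
rewrite (cX a) (cX b) opprD addrACA subrr addr0.
have [s0|s0] := eqVneq (1 - alpha) 0.
  have z f : (forall i, 0 <= c f i) -> \sum_i c f i = 1 - alpha ->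
      \sum_i c f i *: X i = 0.
    move=> cf0; rewrite s0 => /eqP; rewrite psumr_eq0// => /allP h.
    by rewrite big1// => i _; rewrite (eqP (h i (mem_index_enum i))) scale0r.
  rewrite (z a (c0 a a0 ak) (c1 a a1)) (z b (c0 b b0 bk) (c1 b b1)).
  by rewrite subrr is_norm0// s0 mul0r.
have sp : 0 < 1 - alpha.
  by rewrite lt_neqAle eq_sym s0 -(c1 a a1) sumr_ge0// => i _; exact: c0.
rewrite -(ler_pM2l sp) -{1}(gtr0_norm sp) -is_normZ//.
have -> : (1 - alpha) *: (\sum_i c a i *: X i - \sum_i c b i *: X i) =
    \sum_i \sum_j (c a i * c b j) *: (X i - X j).
  under [RHS]eq_bigr do under eq_bigr do rewrite scalerBr.
  under [RHS]eq_bigr do rewrite sumrB.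
  rewrite [RHS]sumrB scalerBr; congr (_ - _).
    rewrite scaler_sumr; apply: eq_bigr => i _.
    by rewrite -scaler_suml -mulr_sumr (c1 b)// mulrC scalerA.
  rewrite exchange_big/= scaler_sumr; apply: eq_bigr => j _.
  by rewrite -scaler_suml -mulr_suml (c1 a)// scalerA.
apply: le_trans (is_norm_sum hN _ _ _) _.
apply: (@le_trans _ _ (\sum_i \sum_j (c a i * c b j) * D)).
  apply: ler_sum => i _; apply: le_trans (is_norm_sum hN _ _ _) _.
  apply: ler_sum => j _; rewrite is_normZ// ger0_norm ?mulr_ge0 ?c0//.
  by apply: ler_wpM2l => //; rewrite mulr_ge0 ?c0.
under eq_bigr do rewrite -mulr_suml -mulr_sumr (c1 b)//.
by rewrite -mulr_suml -mulr_suml (c1 a)// mulrA.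
Qed.

End Contraction.

(** Sum the recursion over [t]; its first [L] terms are bounded directly. *)
Lemma contraction_sum (R : realType) (L T : nat) (alpha : R) (a e : nat -> R) :
  0 <= alpha <= 1 -> (forall t, 0 <= a t) -> (forall t, 0 <= e t) ->
  (forall t, (t < T)%N -> a t <= 2 * \sum_(q < t) e q) ->
  (forall t, (t + L < T)%N ->
     a (t + L)%N <= (1 - alpha) * a t + 2 * \sum_(q < L) e (t + q)%N) ->
  alpha * \sum_(t < T) a t <= 4 * L%:R * \sum_(t < T) e t.
Proof.
move=> /andP[al0 al1] a0 e0 h1 h2.
have emono p q : (p <= q)%N -> \sum_(t < p) e t <= \sum_(t < q) e t.
  by move=> /subnKC <-; rewrite big_split_ord/= lerDl sumr_ge0.
set E := \sum_(t < T) e t.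
have E0 : 0 <= E by rewrite sumr_ge0.
have head n : (n <= T)%N -> \sum_(t < n) a t <= 2 * n%:R * E.
  move=> nT; apply: (@le_trans _ _ (\sum_(t < n) 2 * E)).
    apply: ler_sum => t _; have tT := leq_trans (ltn_ord t) nT.
    apply: le_trans (h1 _ tT) _; rewrite ler_pM2l//; apply: emono; exact: ltnW.
  by rewrite sumr_const card_ord -mulr_natl; lra.
have [TL|LT] := leqP T L.
  have TL' : T%:R <= L%:R :> R by rewrite ler_nat.
  have := head _ (leqnn T); have : 0 <= \sum_(t < T) a t by rewrite sumr_ge0.
  have : 0 <= T%:R :> R by [].
  move: (\sum_(t < T) a t) (T%:R) (L%:R) TL' => A t l TL' t0 A0 hA.
  nra.
have [n Tn] : exists n, T = (L + n)%N by exists (T - L)%N; rewrite subnKC// ltnW.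
have tail : \sum_(t < n) a (L + t)%N <=
    (1 - alpha) * \sum_(t < T) a t + 2 * L%:R * E.
  apply: (@le_trans _ _ (\sum_(t < n)
      ((1 - alpha) * a t + 2 * \sum_(q < L) e (t + q)%N))).
    apply: ler_sum => t _; rewrite addnC; apply: h2.
    by rewrite Tn addnC ltn_add2l.
  rewrite big_split/= -!mulr_sumr; apply: lerD.
    apply: ler_wpM2l; first by rewrite subr_ge0.
    by rewrite Tn addnC big_split_ord/= lerDl sumr_ge0.
  rewrite -mulrA ler_pM2l// exchange_big/=.
  rewrite mulr_natl -[X in _ *+ X]card_ord -sumr_const; apply: ler_sum => q _.
  apply: (@le_trans _ _ (\sum_(t < q + n) e t)).
    rewrite big_split_ord/= -[X in X <= _]add0r; apply: lerD; first by rewrite sumr_ge0.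
    by apply: ler_sum => t _; rewrite addnC.
  by apply: emono; rewrite Tn leq_add2r ltnW.
have := head L (ltnW LT).
move: tail; rewrite Tn big_split_ord/=; lra.
Qed.

Section Consensus.
Context {R : realType} {d m : nat} (N : 'rV[R]_d -> R) (hN : is_norm N).
Context (W : nat -> 'M[R]_m) (B : nat) (zeta : R).
Context (B0 : (0 < B)%N) (zeta0 : 0 < zeta) (hW : network_assumption zeta B W).
Context (T : nat) (x y : 'I_m -> nat -> 'rV[R]_d) (E : nat -> R).
Context (x1 : forall i j, x i 1%N = x j 1%N).
Context (hmix : forall i t, (1 <= t <= T)%N ->
  x i t.+1 = \sum_j W t i j *: y j t).
Context (hE : forall i t, (1 <= t <= T)%N -> N (y i t - x i t) <= E t).
Context (E0 : forall t, 0 <= E t).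

Lemma perturbed_transition s n i : (0 < s)%N -> (s + n <= T.+1)%N ->
  N (x i (s + n) - \sum_k transition W s n i k *: x k s) <=
  \sum_(q < n) E (s + q).
Proof.
move=> s0; elim: n i => [|n IH] i snT.
  rewrite big_ord0 addn0 (bigD1 i)//= big1 => [|k /negbTE ki]; last first.
    by rewrite mxE eq_sym ki scale0r.
  by rewrite mxE eqxx scale1r addr0 subrr is_norm0.
have sn : (1 <= s + n <= T)%N.
  by rewrite addn_gt0 s0/= -ltnS -addnS.
rewrite addnS hmix// big_ord_recr/=.
have -> : \sum_j W (s + n) i j *: y j (s + n) -
    \sum_k (W (s + n) *m transition W s n) i k *: x k s =
    \sum_j W (s + n) i j *: ((x j (s + n) -
       \sum_k transition W s n j k *: x k s) + (y j (s + n) - x j (s + n))).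
  under [in RHS]eq_bigr do rewrite addrC addrA subrK scalerBr.
  rewrite sumrB; congr (_ - _).
  under eq_bigr do rewrite mxE scaler_suml.
  rewrite exchange_big/=; apply: eq_bigr => j _.
  by rewrite scaler_sumr; apply: eq_bigr => k _; rewrite scalerA.
apply: le_trans (is_norm_sum hN _ _ _) _.
rewrite -[leRHS]mul1r -(mixing_row hW i (proj1 (andP sn))) mulr_suml.
apply: ler_sum => j _.
rewrite is_normZ// ger0_norm ?(mixing_ge0 hW)//; last by case/andP: sn.
apply: ler_wpM2l; first by rewrite (mixing_ge0 hW)//; case/andP: sn.
apply: le_trans (is_normD hN _ _) _; apply: lerD; last exact: hE.
by apply: IH; rewrite ltnW// -addnS.
Qed.

(** The total disagreement between the nodes is controlled by the total local
    displacement, since averaging contracts the diameter of the states by a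
    fixed factor over [m + 1] blocks. *)
Lemma consensus i j :
  zeta ^+ (m.+1 * B) * \sum_(1 <= t < T.+1) N (x i t - x j t) <=
  4 * (m.+1 * B)%:R * \sum_(1 <= t < T.+1) E t.
Proof.
set L := (m.+1 * B)%N; set alpha := zeta ^+ L.
have z1 := zeta_le1 hW i.
have al0 : 0 <= alpha by rewrite exprn_ge0// ltW.
have al1 : alpha <= 1 by rewrite exprn_ile1// ltW.
pose D t := \big[Num.max/0]_(p : 'I_m * 'I_m) N (x p.1 t - x p.2 t).
have DN t a b : N (x a t - x b t) <= D t.
  by rewrite /D; apply/bigmax_geP; right; exists (a, b).
have D0 t : 0 <= D t by apply: le_trans (DN t i j); exact: is_norm_ge0.
have Dle t c : 0 <= c -> (forall a b, N (x a t - x b t) <= c) -> D t <= c.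
  by move=> c0 h; apply/bigmax_leP; split => // -[a b] _; exact: h.
have step s n a b (X := fun k => x k s) : (0 < s)%N -> (s + n <= T.+1)%N ->
    N (x a (s + n) - x b (s + n)) <=
    N (\sum_k transition W s n a k *: X k - \sum_k transition W s n b k *: X k)
    + 2 * \sum_(q < n) E (s + q).
  move=> s0 snT.
  have ha := perturbed_transition a s0 snT.
  have hb := perturbed_transition b s0 snT.
  set u := \sum_k _ *: X k in ha *; set v := \sum_k _ *: X k in hb *.
  have -> : x a (s + n) - x b (s + n) =
      (u - v) + ((x a (s + n) - u) - (x b (s + n) - v)).
    by apply/rowP => k; rewrite !mxE; ring.
  apply: le_trans (is_normD hN _ _) _; rewrite lerD2l.
  apply: le_trans (is_normD hN _ _) _; rewrite is_normN//.
  by rewrite mulrDl mul1r lerD.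
apply: (@le_trans _ _ (alpha * \sum_(t < T) D t.+1)).
  rewrite ler_wpM2l// big_add1/= big_mkord; apply: ler_sum => t _; exact: DN.
rewrite big_add1/= big_mkord.
apply: (@contraction_sum _ L T alpha (fun t => D t.+1) (fun t => E t.+1)) => //.
- by rewrite al0.
- move=> t tT; apply: Dle; first by rewrite mulr_ge0// sumr_ge0.
  move=> a b; apply: le_trans (step 1%N t a b isT (leqW tT)) _.
  rewrite [X in N X](_ : _ = 0).
    by rewrite is_norm0// add0r.
  apply/eqP; rewrite subr_eq0.
  have tr c : \sum_k transition W 1 t c k *: x k 1%N = x a 1%N.
    under eq_bigr do rewrite (x1 _ a).
    by rewrite -scaler_suml (transition_row hW)// scale1r.
  by rewrite !tr.
- move=> t tT; apply: Dle.
    by rewrite addr_ge0 ?mulr_ge0 ?subr_ge0// sumr_ge0.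
  move=> a b; apply: le_trans (step t.+1 L a b isT (leqW tT)) _.
  rewrite lerD2r; apply: (convex_combination_contraction hN (k := i)) => //.
  + by move=> k; exact: (transition_ge0 hW).
  + by move=> k; exact: (transition_ge0 hW).
  + exact: (transition_row hW).
  + exact: (transition_row hW).
  + exact: (transition_ge B0 zeta0 hW).
  + exact: (transition_ge B0 zeta0 hW).
Qed.

End Consensus.

(** * Random vectors and bounded expectations *)

Section RandomVectors.
Context {R : realType} {d : nat} {disp : measure_display}
  {Om : measurableType disp}.
Implicit Types (X Y : Om -> 'rV[R]_d).

(** An open set is a countable union of rational boxes. *)
Lemma random_vector_of_coord X :
  (forall k, measurable_fun [set: Om] (fun o => X o 0 k)) -> random_vector X.
Proof.
move=> mX; apply: (@measurability _ _ Om borelV setT X (@open 'rV[R]_d)) => // _ [U oU <-].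
rewrite setTI.
pose box (q : 'rV[rat]_d * nat) : set 'rV[R]_d :=
  [set z | forall k, `|ratr (q.1 0 k) - z 0 k| < q.2.+1%:R^-1].
pose F (q : 'rV[rat]_d * nat) : set Om :=
  if `[< box q `<=` U >] then X @^-1` (box q) else set0.
rewrite (_ : X @^-1` U = \bigcup_q F q).
  apply: countable_bigcupT_measurable => [|q]; first exact: countableP.
  rewrite /F; case: ifPn => // _.
  rewrite (_ : _ @^-1` _ = \big[setI/setT]_(k < d)
      [set o | `|ratr (q.1 0 k) - X o 0 k| < q.2.+1%:R^-1]); last first.
    rewrite -bigcap_seq; apply/seteqP; split => o /= h k.
      by move=> _; exact: h.
    by apply: h; rewrite /= mem_index_enum.
  apply: bigsetI_measurable => k _.
  have mf : measurable_fun setT (fun o => `|ratr (q.1 0 k) - X o 0 k|).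
    by apply: measurableT_comp => //; apply: measurable_funB => //; exact: mX.
  have := measurable_fun_ltr mf (measurable_cst (q.2.+1%:R^-1 : R)).
  by move=> /(_ measurableT [set true] I); rewrite setTI.
apply/seteqP; split; last first.
  move=> o [q _]; rewrite /F; case: ifPn => // /asboolP qU Xq; exact: qU.
move=> o XU.
have /nbhs_ballP[e /= e0 eU] : nbhs (X o) U by exact: open_nbhs_nbhs.
have [|n] := @ltr_add_invr R 0 (e / 2); first by rewrite divr_gt0.
rewrite add0r => ne.
have n0 : 0 < n.+1%:R^-1 :> R by rewrite invr_gt0.
have qE k : exists q : rat, `|ratr q - X o 0 k| < n.+1%:R^-1.
  have [|q] := @rat_in_itvoo R (X o 0 k) (X o 0 k + n.+1%:R^-1).
    by rewrite ltrDl.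
  rewrite in_itv/= => /andP[q1 q2]; exists q.
  by rewrite ger0_norm ?subr_ge0 ?ltrBlDl// ltW.
exists (\row_k xchoose (qE k), n) => //.
rewrite /F; case: ifPn => [_ k/=|/asboolPn]; first by rewrite mxE; exact: (xchooseP (qE k)).
case=> z /= hz; apply: eU; rewrite -ball_normE/=.
rewrite [ltLHS]/Num.norm/= mx_normrE; apply/bigmax_ltP; split => //.
move=> [i k] _ /=; rewrite !mxE (ord1 i).
have := xchooseP (qE k); have := hz k; rewrite mxE.
move: (ratr _) => q h1 h2.
rewrite (_ : _ - _ = - (q - X o 0 k) + (q - z 0 k)); last by ring.
apply: le_lt_trans (ler_normD _ _) _; rewrite normrN.
by rewrite (splitr e) ltrD// ?(lt_trans h2 ne)// (lt_trans h1 ne).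
Qed.

(** Only the values of [f] on the range of [X] matter, although this range need
    not be measurable: sublevel sets of [f] are traces of open sets. *)
Lemma measurable_lipschitz_comp_on (D : set Om) (K : set 'rV[R]_d)
    (f : 'rV[R]_d -> R) (c : R) X :
  random_vector X -> (forall o, D o -> K (X o)) -> 0 < c ->
  (forall a b, K a -> K b -> `|f a - f b| <= c * `|a - b|) ->
  measurable_fun D (fun o => f (X o)).
Proof.
move=> mX KX c0 fc mD; apply: (measurability (@RGenInftyO.G R)) (mD).
  exact: RGenInftyO.measurableE.
move=> _ [_ [v ->] <-].
pose U := \bigcup_(a in [set a | K a /\ f a < v]) ball a ((v - f a) / c).
have oU : open U by apply: bigcup_open => a _; exact: ball_open.
rewrite (_ : _ `&` _ = D `&` ([set: Om] `&` X @^-1` U)).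
  by apply: measurableI => //; apply: mX => //; exact: sub_sigma_algebra.
rewrite setTI; apply/seteqP; split => o /=; rewrite in_itv/=.
  move=> [Do fv]; split => //; exists (X o); first by split; [exact: KX|].
  by apply: ballxx; rewrite divr_gt0// subr_gt0.
move=> [Do [a [Ka fa]]]; rewrite -ball_normE/= ltr_pdivlMr// mulrC => h; split => //.
have := le_lt_trans (fc _ _ Ka (KX o Do)) h.
by rewrite ltr_norml => /andP[]; lra.
Qed.

Lemma measurable_lipschitz_comp (K : set 'rV[R]_d) (f : 'rV[R]_d -> R) (c : R) X :
  random_vector X -> (forall o, K (X o)) -> 0 < c ->
  (forall a b, K a -> K b -> `|f a - f b| <= c * `|a - b|) ->
  measurable_fun [set: Om] (fun o => f (X o)).
Proof. by move=> mX KX; apply: measurable_lipschitz_comp_on. Qed.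

Lemma random_vector_coord X k :
  random_vector X -> measurable_fun [set: Om] (fun o => X o 0 k).
Proof.
move=> mX; apply: (@measurable_lipschitz_comp setT (fun z => z 0 k) 1) => //.
move=> a b _ _; rewrite mul1r.
by rewrite (_ : a 0 k - b 0 k = (a - b) 0 k) ?coord_le_mx_norm// !mxE.
Qed.

Lemma random_vector_cst (z : 'rV[R]_d) : random_vector (fun _ : Om => z).
Proof. by apply: random_vector_of_coord => k; exact: measurable_cst. Qed.

Lemma random_vectorD X Y : random_vector X -> random_vector Y ->
  random_vector (fun o => X o + Y o).
Proof.
move=> mX mY; apply: random_vector_of_coord => k.
rewrite (_ : (fun _ => _) = (fun o => X o 0 k + Y o 0 k)).
  by apply: measurable_funD; exact: random_vector_coord.
by apply/funext => o; rewrite mxE.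
Qed.

Lemma random_vectorZ (c : R) X : random_vector X ->
  random_vector (fun o => c *: X o).
Proof.
move=> mX; apply: random_vector_of_coord => k.
rewrite (_ : (fun _ => _) = (fun o => c * X o 0 k)).
  by apply: measurable_funM => //; exact: random_vector_coord.
by apply/funext => o; rewrite mxE.
Qed.

Lemma random_vectorB X Y : random_vector X -> random_vector Y ->
  random_vector (fun o => X o - Y o).
Proof.
move=> mX mY; rewrite (_ : (fun _ => _) = (fun o => X o + (-1) *: Y o)).
  by apply: random_vectorD => //; exact: random_vectorZ.
by apply/funext => o; rewrite scaleN1r.
Qed.

Lemma random_vector_sum n (F : 'I_n -> Om -> 'rV[R]_d) :
  (forall i, random_vector (F i)) -> random_vector (fun o => \sum_i F i o).
Proof.
move=> mF; apply: random_vector_of_coord => k.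
rewrite (_ : (fun _ => _) = (fun o => \sum_i F i o 0 k)).
  by apply: measurable_sum => i; exact: random_vector_coord.
by apply/funext => o; rewrite summxE.
Qed.

Lemma measurable_dotv X Y : random_vector X -> random_vector Y ->
  measurable_fun [set: Om] (fun o => dotv (X o) (Y o)).
Proof.
move=> mX mY; rewrite (_ : (fun _ => _) = (fun o => \sum_k X o 0 k * Y o 0 k)).
  by apply: measurable_sum => k; apply: measurable_funM; exact: random_vector_coord.
by apply/funext => o; rewrite dotvE.
Qed.

End RandomVectors.

Section BoundedExpectation.
Context {R : realType} {disp : measure_display} {Om : measurableType disp}.
Implicit Types (Pr : probability Om R) (f g : Om -> R).

Definition bounded_measurable f : Prop :=
  measurable_fun [set: Om] f /\ exists M : R, forall o, `|f o| <= M.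

Lemma bounded_measurable_integrable Pr f :
  bounded_measurable f -> Pr.-integrable [set: Om] (EFin \o f).
Proof.
move=> [mf [M fM]]; apply: measurable_bounded_integrable => //.
  by rewrite (le_lt_trans (probability_le1 _ _))// ltry.
by exists M; split; [exact: num_real|move=> x Mx o _ /=; exact: le_trans (fM o) (ltW Mx)].
Qed.

Lemma bounded_measurable_cst (c : R) : bounded_measurable (fun=> c).
Proof. by split; [exact: measurable_cst | exists `|c|]. Qed.

Lemma bounded_measurableD f g :
  bounded_measurable f -> bounded_measurable g ->
  bounded_measurable (fun o => f o + g o).
Proof.
move=> [mf [M fM]] [mg [M' gM]]; split; first exact: measurable_funD.
exists (M + M') => o; apply: le_trans (ler_normD _ _) _.
by rewrite lerD.
Qed.

Lemma bounded_measurableM f g :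
  bounded_measurable f -> bounded_measurable g ->
  bounded_measurable (fun o => f o * g o).
Proof.
move=> [mf [M fM]] [mg [M' gM]]; split; first exact: measurable_funM.
by exists (M * M') => o; rewrite normrM ler_pM.
Qed.

Lemma bounded_measurableB f g :
  bounded_measurable f -> bounded_measurable g ->
  bounded_measurable (fun o => f o - g o).
Proof.
move=> hf hg; rewrite (_ : (fun _ => _) = (fun o => f o + (-1) * g o)).
  by apply/bounded_measurableD/bounded_measurableM => //; exact: bounded_measurable_cst.
by apply/funext => o; rewrite mulN1r.
Qed.

Lemma bounded_measurable_sum (I : Type) (s : seq I) (F : I -> Om -> R) :
  (forall i, bounded_measurable (F i)) ->
  bounded_measurable (fun o => \sum_(i <- s) F i o).
Proof.
move=> hF; elim: s => [|i s IH].
  by under eq_fun do rewrite big_nil; exact: bounded_measurable_cst.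
by under eq_fun do rewrite big_cons; exact: bounded_measurableD.
Qed.

Lemma RintegralD_bounded Pr f g :
  bounded_measurable f -> bounded_measurable g ->
  (\int[Pr]_o (f o + g o) = \int[Pr]_o f o + \int[Pr]_o g o)%R.
Proof. by move=> hf hg; rewrite RintegralD//; exact: bounded_measurable_integrable. Qed.

Lemma RintegralZl_bounded Pr (c : R) f : bounded_measurable f ->
  (\int[Pr]_o (c * f o) = c * \int[Pr]_o f o)%R.
Proof. by move=> hf; rewrite RintegralZl//; exact: bounded_measurable_integrable. Qed.

Lemma Rintegral_sum_bounded Pr (I : Type) (s : seq I) (F : I -> Om -> R) :
  (forall i, bounded_measurable (F i)) ->
  (\int[Pr]_o (\sum_(i <- s) F i o) = \sum_(i <- s) \int[Pr]_o F i o)%R.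
Proof.
move=> hF; elim: s => [|i s IH].
  under eq_Rintegral do rewrite big_nil.
  by rewrite big_nil Rintegral_cst// mul0r.
under eq_Rintegral do rewrite big_cons.
by rewrite big_cons RintegralD_bounded ?IH//; exact: bounded_measurable_sum.
Qed.

Lemma Rintegral_prob_cst Pr (c : R) : (\int[Pr]_o c = c)%R.
Proof. by rewrite Rintegral_cst// [X in fine X]probability_setT mulr1. Qed.

Lemma le_Rintegral_bounded Pr f g :
  bounded_measurable f -> bounded_measurable g ->
  (forall o, f o <= g o) -> (\int[Pr]_o f o <= \int[Pr]_o g o)%R.
Proof.
move=> hf hg fg; apply: le_Rintegral => //; exact: bounded_measurable_integrable.
Qed.

Lemma expectation_bounded Pr f : bounded_measurable f ->
  ('E_Pr[f] = (\int[Pr]_o f o)%:E)%E.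
Proof.
move=> hf; rewrite unlock /Rintegral fineK//.
exact: integrable_fin_num (bounded_measurable_integrable Pr hf).
Qed.

End BoundedExpectation.

(** * Decoupling and the uniform law on the sphere *)

Section Decoupling.
Context {R : realType} {disp d1 d2 : measure_display} {Om : measurableType disp}
  {T1 : measurableType d1} {T2 : measurableType d2} (Pr : probability Om R).
Context (p1 : Om -> T1) (p2 : Om -> T2).
Context (m1 : measurable_fun setT p1) (m2 : measurable_fun setT p2).
Context (indep : forall A B, measurable A -> measurable B ->
  Pr (p1 @^-1` A `&` p2 @^-1` B) = (Pr (p1 @^-1` A) * Pr (p2 @^-1` B))%E).

(** By independence the joint law is the product law, so that Tonelli's theorem
    lets the second variable be replaced by an independent copy. *)
Lemma integral_decoupling (f : T1 * T2 -> \bar R) :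
  measurable_fun setT f -> (forall z, 0 <= f z)%E ->
  (\int[Pr]_o f (p1 o, p2 o) = \int[Pr]_o \int[Pr]_o' f (p1 o, p2 o'))%E.
Proof.
move=> mf f0.
pose P1 : {mfun Om >-> T1} := HB.pack p1 (isMeasurableFun.Build _ _ _ _ _ m1).
pose P2 : {mfun Om >-> T2} := HB.pack p2 (isMeasurableFun.Build _ _ _ _ _ m2).
have m12 : measurable_fun setT (fun o => (p1 o, p2 o)) by exact: measurable_fun_pair.
pose P12 : {mfun Om >-> (T1 * T2)%type} :=
  HB.pack (fun o => (p1 o, p2 o)) (isMeasurableFun.Build _ _ _ _ _ m12).
transitivity (\int[distribution Pr P12]_z f z)%E.
  by rewrite ge0_integral_distribution.
transitivity (\int[distribution Pr P1 \x distribution Pr P2]_z f z)%E.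
  apply: eq_measure_integral => A mA _; apply/esym.
  by apply: product_measure_unique => // B C mB mC; exact: indep.
rewrite fubini_tonelli1// ge0_integral_distribution//; last 2 first.
- exact: measurable_fun_fubini_tonelli_F.
- by move=> y; exact: integral_ge0.
apply: eq_integral => o _ /=; rewrite /fubini_F ge0_integral_distribution//.
by apply: measurableT_comp => //; exact: pair1_measurable.
Qed.

Lemma measurable_partial_integral (f : T1 * T2 -> \bar R) :
  measurable_fun setT f -> (forall z, 0 <= f z)%E ->
  measurable_fun setT (fun o => \int[Pr]_o' f (p1 o, p2 o'))%E.
Proof.
move=> mf f0.
pose P2 : {mfun Om >-> T2} := HB.pack p2 (isMeasurableFun.Build _ _ _ _ _ m2).
rewrite (_ : (fun _ => _) = fubini_F (distribution Pr P2) f \o p1).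
  by apply: measurableT_comp => //; exact: measurable_fun_fubini_tonelli_F.
apply/funext => o /=; rewrite /fubini_F ge0_integral_distribution//.
by apply: measurableT_comp => //; exact: pair1_measurable.
Qed.

(** The bound [M] reduces the claim to the nonnegative function [h + M]. *)
Lemma Rintegral_decoupling_ge0 (h : T1 * T2 -> R) (M : R) :
  measurable_fun setT h -> (forall z, `|h z| <= M) ->
  (forall o, 0 <= \int[Pr]_o' h (p1 o, p2 o'))%R ->
  (0 <= \int[Pr]_o h (p1 o, p2 o))%R.
Proof.
move=> mh hM h0.
have hb : bounded_measurable (fun o => h (p1 o, p2 o)).
  split; last by exists M.
  by apply: measurableT_comp => //; exact: measurable_fun_pair.
have hb2 o : bounded_measurable (fun o' => h (p1 o, p2 o')).
  split; last by exists M.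
  apply: measurableT_comp => //; apply: measurable_fun_pair => //.
have cM := @bounded_measurable_cst _ _ Om M.
have hMb := bounded_measurableD hb cM.
rewrite -(@lerD2r _ M) add0r -{2}(Rintegral_prob_cst Pr M).
rewrite -(RintegralD_bounded Pr hb cM) -lee_fin -expectation_bounded// unlock.
have mf : measurable_fun setT (fun z => (h z + M)%:E).
  by apply/measurable_EFinP; exact: measurable_funD.
have f0 z : (0 <= (h z + M)%:E)%E.
  by rewrite lee_fin; have := hM z; rewrite ler_norml => /andP[]; lra.
rewrite (integral_decoupling mf f0).
rewrite -[leLHS](_ : \int[Pr]_o M%:E = _)%E; last first.
  by rewrite integral_cst// [X in (_ * X)%E]probability_setT mule1.
apply: ge0_le_integral => //.
- move=> o _; rewrite lee_fin; exact: le_trans (normr_ge0 _) (hM (p1 o, p2 o)).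
- exact: (measurable_partial_integral mf f0).
move=> o _; have := bounded_measurableD (hb2 o) cM => hb2M.
have := expectation_bounded Pr hb2M; rewrite unlock => ->.
by rewrite lee_fin RintegralD_bounded// Rintegral_prob_cst lerDr.
Qed.

End Decoupling.

Section Sphere.
Context {R : realType} {d : nat}.
Implicit Types (a b v z : 'rV[R]_d) (S : set 'rV[R]_d) (f g : 'rV[R]_d -> R).

Definition sphere : set 'rV[R]_d := [set a | norm2 a = 1].

Definition bounded_lipschitz S f : Prop := exists2 c, 0 < c &
  (forall a, S a -> `|f a| <= c) /\
  (forall a b, S a -> S b -> `|f a - f b| <= c * `|a - b|).

Lemma bounded_lipschitzM S f g : bounded_lipschitz S f ->
  bounded_lipschitz S g -> bounded_lipschitz S (fun a => f a * g a).
Proof.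
move=> [c c0 [fb fl]] [c' c'0 [gb gl]].
exists (2 * c * c'); first by rewrite !mulr_gt0.
split=> [a Sa|a b Sa Sb].
  rewrite normrM; have : `|f a| * `|g a| <= c * c' by rewrite ler_pM// ?fb ?gb.
  by have := mulr_gt0 c0 c'0; lra.
rewrite (_ : _ - _ = f a * (g a - g b) + (f a - f b) * g b); last by ring.
apply: le_trans (ler_normD _ _) _; rewrite !normrM.
have -> : 2 * c * c' * `|a - b| = c * (c' * `|a - b|) + c * `|a - b| * c' by ring.
by apply: lerD; apply: ler_pM; rewrite ?fb ?gb ?fl ?gl.
Qed.

Lemma bounded_lipschitzZ S (k : R) f :
  bounded_lipschitz S f -> bounded_lipschitz S (fun a => k * f a).
Proof.
move=> [c c0 [fb fl]]; apply: bounded_lipschitzM; last by exists c.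
exists (`|k| + 1); first by rewrite ltr_wpDl.
split=> [a _|a b _ _]; first by rewrite lerDl.
by rewrite subrr normr0 mulr_ge0// addr_ge0.
Qed.

Lemma coord_le_norm2 a k : `|a 0 k| <= norm2 a.
Proof.
rewrite -(@ler_pXn2r _ 2)// ?nnegrE ?norm2_ge0// sqr_norm2 real_normK ?num_real//.
rewrite dotvE (bigD1 k)//= -expr2 lerDl sumr_ge0// => i _.
by rewrite -expr2 sqr_ge0.
Qed.

Lemma mx_norm_le_norm2 a : `|a| <= norm2 a.
Proof.
rewrite [leLHS]/Num.norm/= mx_normrE; apply/bigmax_leP; split.
  exact: norm2_ge0.
by move=> [i k] _ /=; rewrite (ord1 i) coord_le_norm2.
Qed.

Lemma normr_dotv_le v a : `|dotv a v| <= `|a| * \sum_k `|v 0 k|.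
Proof.
rewrite dotvE mulr_sumr; apply: le_trans (ler_norm_sum _ _ _) _.
by apply: ler_sum => k _; rewrite normrM ler_wpM2r// coord_le_mx_norm.
Qed.

Lemma bounded_lipschitz_dotv v : bounded_lipschitz sphere (dotv^~ v).
Proof.
exists (1 + \sum_k `|v 0 k|); first by rewrite ltr_pwDl// sumr_ge0.
have s0 : 0 <= \sum_k `|v 0 k| by rewrite sumr_ge0.
split=> [a a1|a b _ _].
  apply: le_trans (normr_dotv_le _ _) _; rewrite -[leLHS]add0r.
  apply: lerD => //; rewrite -[leRHS]mul1r ler_wpM2r//.
  by rewrite -a1 mx_norm_le_norm2.
rewrite -dotvBl; apply: le_trans (normr_dotv_le _ _) _.
by rewrite mulrC ler_wpM2r// lerDr.
Qed.

Lemma sphere_bounded_measurable {disp : measure_display}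
    {Om : measurableType disp} (V : Om -> 'rV[R]_d) (f : 'rV[R]_d -> R) :
  random_vector V -> (forall o, norm2 (V o) = 1) ->
  bounded_lipschitz sphere f -> bounded_measurable (fun o => f (V o)).
Proof.
move=> mV V1 [c c0 [fb fl]]; split; last by exists c => o; apply: fb; exact: V1.
exact: (@measurable_lipschitz_comp _ _ _ _ sphere f c V mV V1 c0 fl).
Qed.

Context {disp : measure_display} {Om : measurableType disp}
  (Pr : probability Om R) (U : Om -> 'rV[R]_d).
Context (hU : uniform_on_sphere Pr U).

Lemma random_vector_mulmx (V : Om -> 'rV[R]_d) (Q : 'M[R]_d) :
  random_vector V -> random_vector (fun o => V o *m Q).
Proof.
move=> mV; apply: random_vector_of_coord => k.
rewrite (_ : (fun _ => _) = (fun o => \sum_j V o 0 j * Q j k)).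
  apply: measurable_sum => j; apply: measurable_funM => //.
  exact: random_vector_coord.
by apply/funext => o; rewrite mxE.
Qed.

(** [f] is only controlled on the sphere; outside of it, it is replaced by [0]
    in order to integrate it against the law of [U]. *)
Lemma Rintegral_sphere_invariant (Q : 'M[R]_d) (f : 'rV[R]_d -> R) :
  Q *m Q^T = 1%:M -> bounded_lipschitz sphere f ->
  (\int[Pr]_o f (U o *m Q) = \int[Pr]_o f (U o))%R.
Proof.
move=> QQ [c c0 [fb fl]]; have [mU U1 invU] := hU.
have UQ1 o : sphere (U o *m Q).
  by rewrite /sphere/= /norm2 dotv_mulmx -mulmxA QQ mulmx1; exact: U1.
have mUQ := random_vector_mulmx Q mU.
have mid : random_vector (fun a : borelV => a : 'rV[R]_d) := @measurable_id _ borelV setT.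
pose V : {mfun Om >-> borelV} := HB.pack (U : Om -> borelV)
  (isMeasurableFun.Build _ _ _ _ _ mU).
pose VQ : {mfun Om >-> borelV} := HB.pack ((fun o => U o *m Q) : Om -> borelV)
  (isMeasurableFun.Build _ _ _ _ _ mUQ).
have mS : measurable (sphere : set borelV).
  rewrite (_ : sphere = [set: borelV] `&` (fun a : borelV => dotv a a) @^-1` [set 1]).
    exact: (measurable_dotv mid mid measurableT (measurable_set1 1)).
  rewrite setTI; apply/seteqP; split => a /=; rewrite /sphere/= -sqr_norm2.
    by move=> ->; rewrite expr1n.
  by move=> /eqP; rewrite sqrp_eq1 ?norm2_ge0// => /eqP.
have mg : measurable_fun [set: borelV] ((f : borelV -> R) \_ (sphere : set borelV)).
  apply/(measurable_restrictT _ mS).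
  exact: (@measurable_lipschitz_comp_on _ _ _ _ _ sphere f c _ mid (fun _ h => h) c0 fl).
set g := (f \_ _) in mg.
have gE a : sphere a -> f a = g a by move=> Sa; rewrite /g patchE mem_set.
have gb a : `|g a| <= c.
  rewrite /g patchE; case: ifPn => [|_]; first by rewrite inE => /fb.
  by rewrite normr0 ltW.
transitivity (\int[distribution Pr VQ]_a g a).
  rewrite /Rintegral integral_distribution; last 2 first.
  - exact/measurable_EFinP.
  - apply: bounded_measurable_integrable; split; last by exists c => o; exact: gb.
    exact: measurableT_comp.
  by congr fine; apply: eq_integral => o _ /=; rewrite gE.
transitivity (\int[distribution Pr V]_a g a).
  rewrite /Rintegral; congr fine; apply: eq_measure_integral => A mA _.
  exact: invU.
rewrite /Rintegral integral_distribution; last 2 first.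
- exact/measurable_EFinP.
- apply: bounded_measurable_integrable; split; last by exists c => o; exact: gb.
  exact: measurableT_comp.
by congr fine; apply: eq_integral => o _ /=; rewrite -gE.
Qed.

(** By invariance [<U, v>] is distributed as [norm2 v] times any coordinate
    of [U], and the squares of the coordinates add up to [1]. *)
Lemma sphere_second_moment v : (0 < d)%N ->
  (\int[Pr]_o (dotv (U o) v ^+ 2) = dotv v v / d%:R)%R.
Proof.
move=> d0; have [mU U1 _] := hU.
have [->|v0] := eqVneq v 0.
  under eq_Rintegral do rewrite dotv0r expr0n.
  by rewrite Rintegral_prob_cst dotv0r mul0r.
have bl z : bounded_lipschitz sphere (fun a => dotv a z ^+ 2).
  under eq_fun do rewrite expr2.
  by apply: bounded_lipschitzM; exact: bounded_lipschitz_dotv.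
have vn : 0 < norm2 v by rewrite sqrtr_gt0 dotv_gt0.
pose e := (norm2 v)^-1 *: v.
have e1 : norm2 e = 1.
  by rewrite norm2Z normfV ger0_norm ?norm2_ge0// mulVf// gt_eqF.
pose s := (\int[Pr]_o (dotv (U o) e ^+ 2))%R.
have coord (k : 'I_d) : (\int[Pr]_o (dotv (U o) (delta_mx 0 k) ^+ 2) = s)%R.
  have [Q QQ eQ] := orthogonal_unit_transitive e1 (norm2_delta k).
  rewrite -(Rintegral_sphere_invariant QQ (bl _)).
  apply: eq_Rintegral => o _; congr (_ ^+ 2).
  by rewrite dotv_mulmx -eQ -mulmxA QQ mulmx1.
have ds : d%:R * s = 1.
  rewrite mulr_natl -[X in _ *+ X]card_ord -sumr_const.
  rewrite (eq_bigr (fun k : 'I_d =>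
      \int[Pr]_o (dotv (U o) (delta_mx 0 k) ^+ 2)))%R; last first.
    by move=> k _; rewrite coord.
  rewrite -Rintegral_sum_bounded; last by move=> k; exact: (sphere_bounded_measurable mU U1 (bl _)).
  rewrite -[RHS](Rintegral_prob_cst Pr); apply: eq_Rintegral => o _.
  rewrite -[RHS](expr1n _ 2) -(U1 o) sqr_norm2 dotvE; apply: eq_bigr => k _.
  by rewrite dotv_delta.
have sE : s = d%:R^-1.
  by apply: (mulfI (_ : d%:R != 0)); rewrite ?pnatr_eq0 -?lt0n// ds divff ?pnatr_eq0 -?lt0n.
have vE : v = norm2 v *: e by rewrite scalerA divff ?scale1r ?gt_eqF.
transitivity (\int[Pr]_o (norm2 v ^+ 2 * dotv (U o) e ^+ 2))%R.
  by apply: eq_Rintegral => o _; rewrite {1}vE dotvZr exprMn.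
rewrite RintegralZl_bounded; last exact: (sphere_bounded_measurable mU U1 (bl _)).
by rewrite -/s sE sqr_norm2.
Qed.

End Sphere.

(** * Expectation of the two-point estimator *)

Section TwoPoint.
Context {R : realType} {d : nat} (N : 'rV[R]_d -> R) (hN : is_norm N).
Context (K S : set 'rV[R]_d) (G p q delta D : R) (h : 'rV[R]_d -> R).
Context (hp : forall x, N x <= p * norm2 x).
Context (hq : forall x, dual_norm N x <= q * norm2 x).
Context (ch : @convex_function R 'rV[R]_d [set: 'rV[R]_d] h).
Context (hG : lipschitz_wrt N G K h) (d0 : (0 < d)%N) (delta0 : 0 < delta).
Context (SK : S `<=` K).
Context (Sball : forall x e, S x -> norm2 e = 1 -> K (x + delta *: e)).
Context (SD : forall x y, S x -> S y -> N (x - y) <= D).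
Implicit Types (x z u v b e : 'rV[R]_d).

Lemma explore_opp x e : S x -> norm2 e = 1 -> K (x - delta *: e).
Proof. by move=> Sx e1; rewrite -scalerN; apply: Sball => //; rewrite norm2N. Qed.

Lemma norm_dotv_unit u b : norm2 u = 1 -> `|dotv u b| <= q * N b.
Proof.
move=> u1; have le (c : 'rV[R]_d) : dotv u c <= q * N c.
  apply: le_trans (dotv_le_dual hN _ _) _; apply: ler_wpM2r; first exact: is_norm_ge0.
  by apply: le_trans (hq u) _; rewrite u1 mulr1.
by rewrite ler_norml le andbT lerNl -dotvNr -(is_normN hN) le.
Qed.

Lemma two_point_diff_le x u : S x -> norm2 u = 1 ->
  `|h (x + delta *: u) - h (x - delta *: u)| <= `|G| * (2 * delta * p).
Proof.
move=> Sx u1; apply: le_trans (lipschitz_wrt_norm hN hG (Sball Sx u1) (explore_opp Sx u1)) _.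
apply: ler_wpM2l => //.
have -> : x + delta *: u - (x - delta *: u) = (2 * delta) *: u.
  by apply/rowP => k; rewrite !mxE; ring.
by apply: le_trans (hp _) _; rewrite norm2Z u1 mulr1 gtr0_norm ?mulr_gt0// mulrC.
Qed.

Lemma norm_dotv_two_point_grad x u b : S x -> norm2 u = 1 ->
  `|dotv (two_point_grad delta h x u) b| <= `|G| * (p * q * d%:R) * N b.
Proof.
move=> Sx u1; rewrite /two_point_grad dotvZl normrM.
have -> : `|G| * (p * q * d%:R) * N b =
    (d%:R / (2 * delta)) * (`|G| * (2 * delta * p)) * (q * N b).
  by field; rewrite gt_eqF.
have k0 : 0 <= d%:R / (2 * delta) by rewrite divr_ge0// mulr_ge0// ltW.
apply: ler_pM => //; last exact: norm_dotv_unit.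
by rewrite normrM (ger0_norm k0) ler_wpM2l// two_point_diff_le.
Qed.

(** Average the mirror inequality: the estimators of [u] and of its mirror image
    have the same expectation, and the second moment [norm2 v ^+ 2 / d] of
    [<u, v>] cancels the factor [d]. As no derivative of [h] enters, [h] need
    not be smoothed. *)
Lemma two_point_grad_mean {disp : measure_display} {Om : measurableType disp}
    (Pr : probability Om R) (U : Om -> 'rV[R]_d) x v (c : R) :
  uniform_on_sphere Pr U -> S x ->
  (forall e, norm2 e = 1 -> c <= h (x + delta *: e) - h (x + delta *: e - v)) ->
  c <= (\int[Pr]_o dotv (two_point_grad delta h x (U o)) v)%R.
Proof.
move=> hU Sx hc; have [mU U1 _] := hU.
have [v0|v0] := eqVneq v 0.
  have := hc _ (norm2_delta (Ordinal d0)); rewrite v0 subr0 subrr => c0.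
  under eq_Rintegral do rewrite dotv0r.
  by rewrite Rintegral_prob_cst.
have [M M0 NM] := is_norm_le_mx_norm hN.
have lipM a b : K a -> K b -> `|h a - h b| <= `|G| * M * `|a - b|.
  move=> Ka Kb; apply: le_trans (lipschitz_wrt_norm hN hG Ka Kb) _.
  by rewrite -mulrA ler_wpM2l.
pose L := 2 * (`|G| * M * delta).
have L0 : 0 <= L by rewrite !mulr_ge0// ltW.
have bldiff : bounded_lipschitz sphere
    (fun u => h (x + delta *: u) - h (x - delta *: u)).
  exists (L + `|G| * (2 * delta * p) + 1).
    rewrite ltr_wpDl// addr_ge0//.
    exact: le_trans (normr_ge0 _) (two_point_diff_le Sx (norm2_delta (Ordinal d0))).
  have GG : 0 <= `|G| * (2 * delta * p).
    exact: le_trans (normr_ge0 _) (two_point_diff_le Sx (norm2_delta (Ordinal d0))).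
  split=> [u u1|a b a1 b1].
    by apply: le_trans (two_point_diff_le Sx u1) _; lra.
  apply: (@le_trans _ _ (L * `|a - b|)); last by rewrite ler_wpM2r//; lra.
  have := lipM _ _ (Sball Sx a1) (Sball Sx b1).
  have := lipM _ _ (explore_opp Sx b1) (explore_opp Sx a1).
  have -> : x + delta *: a - (x + delta *: b) = delta *: (a - b).
    by apply/rowP => k; rewrite !mxE; ring.
  have -> : x - delta *: b - (x - delta *: a) = delta *: (a - b).
    by apply/rowP => k; rewrite !mxE; ring.
  rewrite normrZ (gtr0_norm delta0) => h1 h2.
  rewrite [X in `|X|](_ : _ = (h (x + delta *: a) - h (x + delta *: b)) +
     (h (x - delta *: b) - h (x - delta *: a))); last by ring.
  by apply: le_trans (ler_normD _ _) _; rewrite /L; lra.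
have bl : bounded_lipschitz sphere (fun u => dotv (two_point_grad delta h x u) v).
  rewrite (_ : (fun _ => _) = (fun u => d%:R / (2 * delta) *
      ((h (x + delta *: u) - h (x - delta *: u)) * dotv u v))).
    by apply/bounded_lipschitzZ/bounded_lipschitzM => //; exact: bounded_lipschitz_dotv.
  by apply/funext => u; rewrite /two_point_grad dotvZl mulrA.
have QQ := householder_orthogonal v0.
have bls : bounded_lipschitz sphere (fun u => dotv u v ^+ 2).
  under eq_fun do rewrite expr2.
  by apply: bounded_lipschitzM; exact: bounded_lipschitz_dotv.
have mb := sphere_bounded_measurable mU U1 bl.
have mbs := sphere_bounded_measurable mU U1 bls.
have mbQ : bounded_measurable
    (fun o => dotv (two_point_grad delta h x (U o *m householder v)) v).
  apply: (sphere_bounded_measurable (V := fun o => U o *m householder v)) bl.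
    exact: random_vector_mulmx.
  by move=> o; rewrite /norm2 dotv_mulmx -mulmxA QQ mulmx1; exact: U1.
have inv := Rintegral_sphere_invariant hU QQ bl.
have d0' : (d%:R : R) != 0 by rewrite pnatr_eq0 -lt0n.
have vv := dotv_gt0 v0.
have cE : 2 * c =
    (\int[Pr]_o (2 * c * d%:R / dotv v v * dotv (U o) v ^+ 2))%R.
  rewrite RintegralZl_bounded// (sphere_second_moment hU v d0).
  by field; rewrite d0' gt_eqF.
rewrite -(@ler_pM2l _ 2)// cE.
rewrite [leRHS](_ : _ =
    (\int[Pr]_o dotv (two_point_grad delta h x (U o)) v) +
    (\int[Pr]_o dotv (two_point_grad delta h x (U o *m householder v)) v))%R; last first.
  by rewrite inv mulr_natl mulr2n.
rewrite -RintegralD_bounded//; apply: le_Rintegral_bounded.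
- by apply: bounded_measurableM => //; exact: bounded_measurable_cst.
- exact: bounded_measurableD.
move=> o; apply: le_trans (two_point_grad_mirror ch delta0 v0 hc (U1 o)).
by rewrite le_eqVlt; apply/orP; left; apply/eqP; ring.
Qed.

Lemma measurable_lip_comp {disp : measure_display} {Om : measurableType disp}
    (X : Om -> 'rV[R]_d) : random_vector X -> (forall o, K (X o)) ->
  measurable_fun [set: Om] (fun o => h (X o)).
Proof.
move=> mX KX; have [M M0 NM] := is_norm_le_mx_norm hN.
apply: (@measurable_lipschitz_comp _ _ _ _ K h (`|G| * M + 1)) => //.
  by rewrite ltr_wpDl// mulr_ge0// ltW.
move=> a b Ka Kb; apply: le_trans (lipschitz_wrt_norm hN hG Ka Kb) _.
apply: (@le_trans _ _ (`|G| * M * `|a - b|)); last by rewrite ler_wpM2r// lerDl.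
by rewrite -mulrA ler_wpM2l.
Qed.

Lemma bounded_measurable_lip {disp : measure_display} {Om : measurableType disp}
    (X : Om -> 'rV[R]_d) z : random_vector X -> (forall o, S (X o)) -> S z ->
  bounded_measurable (fun o => h (X o)).
Proof.
move=> mX SX Sz; split; first by apply: measurable_lip_comp => // o; exact: SK.
exists (`|G| * D + `|h z|) => o; rewrite -lerBlDr; apply: le_trans (lerB_dist _ _) _.
apply: le_trans (lipschitz_wrt_norm hN hG (SK (SX o)) (SK Sz)) _.
by rewrite ler_wpM2l// SD.
Qed.

Lemma bounded_measurable_two_point {disp : measure_display}
    {Om : measurableType disp} (X U : Om -> 'rV[R]_d) z :
  random_vector X -> random_vector U -> (forall o, S (X o)) ->
  (forall o, norm2 (U o) = 1) -> S z ->
  bounded_measurable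
    (fun o => dotv (two_point_grad delta h (X o) (U o)) (X o - z)).
Proof.
move=> mX mU SX U1 Sz; split; last first.
  exists (`| `|G| * (p * q * d%:R)| * D) => o.
  apply: le_trans (norm_dotv_two_point_grad _ (SX o) (U1 o)) _.
  apply: ler_pM => //; [|exact: is_norm_ge0|exact: ler_norm|exact: SD].
  have := norm_dotv_two_point_grad (delta_mx 0 (Ordinal d0)) (SX o) (U1 o).
  move=> /(le_trans (normr_ge0 _)); rewrite pmulr_lge0//.
  apply: is_norm_gt0 => //; apply: contra_eq_neq (norm2_delta (R := R) (Ordinal d0)) => ->.
  by rewrite /norm2 dotv0r sqrtr0 eq_sym oner_neq0.
rewrite (_ : (fun _ => _) = (fun o => d%:R / (2 * delta) *
    (h (X o + delta *: U o) - h (X o - delta *: U o)) * dotv (U o) (X o - z))).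
  apply: measurable_funM.
    apply: measurable_funM => //; apply: measurable_funB.
      apply: measurable_lip_comp => [|o]; last exact: Sball.
      by apply: random_vectorD => //; exact: random_vectorZ.
    apply: measurable_lip_comp => [|o]; last exact: explore_opp.
    by apply: random_vectorB => //; exact: random_vectorZ.
  by apply: measurable_dotv => //; apply: random_vectorB => //; exact: random_vector_cst.
by apply/funext => o; rewrite /two_point_grad dotvZl.
Qed.

(** The estimator is an approximate subgradient in expectation: given the past,
    the query point is fixed and [two_point_grad_mean] applies with
    [v = X - z]. The exploration moves the arguments [X] and [z] of [h] by
    vectors of norm at most [p * delta], whence the error. *)
Lemma bandit_bias {disp : measure_display} {Om : measurableType disp}
    (Pr : probability Om R) (F : set (set Om)) (X U : Om -> 'rV[R]_d) z :
  uniform_on_sphere Pr U -> (F `<=` measurable)%classic ->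
  independent_of Pr U <<s F>> ->
  @random_vector R d _ (g_sigma_algebraType F) X -> (forall o, S (X o)) -> S z ->
  (\int[Pr]_o (h (X o) - h z -
     dotv (two_point_grad delta h (X o) (U o)) (X o - z)) <=
   2 * `|G| * p * delta)%R.
Proof.
move=> hU Fm indep mX SX Sz; have [mU U1 _] := hU.
have sFm : (<<s F>> `<=` @measurable _ Om)%classic.
  apply: smallest_sub => //; exact: sigma_algebra_measurable.
pose T1 := g_sigma_algebraType F.
pose T2 := g_sigma_algebra_preimageType (U : Om -> borelV).
have m1 : measurable_fun [set: Om] (id : Om -> T1).
  by move=> _ A mA; rewrite setTI; exact: sFm.
have m2 : measurable_fun [set: Om] (id : Om -> T2).
  by move=> _ _ [A mA <-]; rewrite setTI; exact: mU.
have ind (A : set T1) (B : set T2) : measurable A -> measurable B ->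
    Pr ((id : Om -> T1) @^-1` A `&` (id : Om -> T2) @^-1` B) =
    (Pr ((id : Om -> T1) @^-1` A) * Pr ((id : Om -> T2) @^-1` B))%E.
  move=> mA [C mC <-]; rewrite setTI !preimage_id setIC muleC.
  exact: indep.
have mX' : random_vector (X : Om -> 'rV[R]_d).
  by move=> _ A mA; rewrite setTI; apply: sFm; rewrite -[X in _ X]setTI; exact: mX.
have mXp : random_vector (fun z : T1 * T2 => X z.1).
  exact: (measurableT_comp mX measurable_fst).
have mUp : random_vector (fun z : T1 * T2 => U z.2).
  have mU2 : random_vector (U : T2 -> 'rV[R]_d) by move=> _ A mA; exists A.
  exact: (measurableT_comp mU2 measurable_snd).
pose bias (x u : 'rV[R]_d) := dotv (two_point_grad delta h x u) (x - z)
  - (h x - (h z + 2 * `|G| * p * delta)).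
have [mPsi [M PsiM]] : bounded_measurable (fun z : T1 * T2 => bias (X z.1) (U z.2)).
  apply: bounded_measurableB.
    exact: (bounded_measurable_two_point mXp mUp (fun o => SX o.1) (fun o => U1 o.2)).
  apply: bounded_measurableB; last exact: bounded_measurable_cst.
  exact: (bounded_measurable_lip mXp (fun o => SX o.1) Sz).
have bm1 := bounded_measurable_two_point mX' mU SX U1 Sz.
have bm2 := bounded_measurable_lip mX' SX Sz.
have pos : (0 <= \int[Pr]_o bias (X o) (U o))%R.
  apply: (Rintegral_decoupling_ge0 m1 m2 ind mPsi PsiM) => o /=.
  have bmo := bounded_measurable_two_point (random_vector_cst (X o)) mU
    (fun=> SX o) U1 Sz.
  rewrite RintegralD_bounded//; last exact: bounded_measurable_cst.
  rewrite Rintegral_prob_cst subr_ge0.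
  apply: two_point_grad_mean => // e e1.
  have Kx := Sball (SX o) e1; have Kz := Sball Sz e1.
  have -> : X o + delta *: e - (X o - z) = z + delta *: e.
    by apply/rowP => k; rewrite !mxE; ring.
  have Ne : N (delta *: e) <= p * delta.
    by apply: le_trans (hp _) _; rewrite norm2Z e1 mulr1 gtr0_norm.
  have := lipschitz_wrt_norm hN hG (SK (SX o)) Kx; have := lipschitz_wrt_norm hN hG Kz (SK Sz).
  rewrite opprD addNKr [z + _ - z]addrAC subrr add0r is_normN// => h1 h2.
  have GN : `|G| * N (delta *: e) <= `|G| * (p * delta) by rewrite ler_wpM2l.
  have := le_trans (ler_norm _) (le_trans h1 GN).
  have := le_trans (ler_norm _) (le_trans h2 GN).
  lra.
have bmb : bounded_measurable (fun o => bias (X o) (U o)).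
  apply: bounded_measurableB => //; apply: bounded_measurableB => //.
  exact: bounded_measurable_cst.
have -> : (\int[Pr]_o (h (X o) - h z -
     dotv (two_point_grad delta h (X o) (U o)) (X o - z)) =
   \int[Pr]_o (2 * `|G| * p * delta + -1 * bias (X o) (U o)))%R.
  by apply: eq_Rintegral => o _; rewrite /bias; ring.
rewrite RintegralD_bounded; last 2 first.
- exact: bounded_measurable_cst.
- by apply: bounded_measurableM => //; exact: bounded_measurable_cst.
rewrite Rintegral_prob_cst (RintegralZl_bounded Pr (-1) bmb); lra.
Qed.

End TwoPoint.

(** * Sums of rates and telescoping divergences *)

Section RateSums.
Context {R : realType}.

Definition root4 (t : nat) : R := Num.sqrt (Num.sqrt t%:R).

Lemma root4_gt0 t : (0 < t)%N -> 0 < root4 t.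
Proof. by move=> t0; rewrite !sqrtr_gt0 ltr0n. Qed.

Lemma root4_ge1 t : (0 < t)%N -> 1 <= root4 t.
Proof. by move=> t0; rewrite -[1]sqrtr1 ler_sqrt -?[X in X <= _]sqrtr1 ?ler_sqrt ?ler1n// sqrtr_ge0. Qed.

Lemma root42 t : root4 t ^+ 2 = Num.sqrt t%:R.
Proof. by rewrite sqr_sqrtr ?sqrtr_ge0. Qed.

Lemma root44 t : root4 t ^+ 4 = t%:R.
Proof. by rewrite (exprM _ 2 2) root42 sqr_sqrtr. Qed.

Lemma powR_root4 t : t%:R `^ (3 / 2) = root4 t ^+ 6 :> R.
Proof.
rewrite (exprM _ 2 3) root42 -powR12_sqrt//.
by rewrite -powR_mulrn ?powR_ge0// -powRrM; congr (_ `^ _); lra.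
Qed.

(** By concavity of the fourth root, [t ^ (-3/4)] is at most four times the
    increment of [t ^ (1/4)] between [t - 1] and [t]. *)
Lemma sum_root4V3 T : \sum_(1 <= t < T.+1) root4 t ^- 3 <= 4 * root4 T.
Proof.
elim: T => [|T IH]; first by rewrite big_geq// mulr_ge0// sqrtr_ge0.
rewrite big_nat_recr//=.
suff : root4 T.+1 ^- 3 <= 4 * (root4 T.+1 - root4 T) by lra.
have b0 := root4_gt0 (ltn0Sn T).
have a0 : 0 <= root4 T by rewrite sqrtr_ge0.
have ab : root4 T <= root4 T.+1.
  by rewrite ler_sqrt ?sqrtr_ge0// ler_sqrt// ler_nat.
have h4 : root4 T.+1 ^+ 4 - root4 T ^+ 4 = 1.
  by rewrite !root44 -natr1; lra.
move: (root4 T.+1) (root4 T) b0 a0 ab h4 => b a b0 a0 ab h4.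
rewrite -[X in X <= _]mul1r ler_pdivrMr ?exprn_gt0//.
suff : b ^+ 4 - a ^+ 4 <= 4 * (b - a) * b ^+ 3 by rewrite h4.
have -> : b ^+ 4 - a ^+ 4 = (b - a) * (b ^+ 3 + b ^+ 2 * a + b * a ^+ 2 + a ^+ 3) by ring.
have -> : 4 * (b - a) * b ^+ 3 = (b - a) * (4 * b ^+ 3) by ring.
apply: ler_wpM2l; first by rewrite subr_ge0.
have h1 : a ^+ 2 <= b ^+ 2 by rewrite ler_pXn2r// ?nnegrE// ltW.
have h2 : b ^+ 2 * a <= b ^+ 2 * b by rewrite ler_wpM2l ?sqr_ge0.
have h3 : b * a ^+ 2 <= b * b ^+ 2 by rewrite ler_wpM2l// ltW.
have h5 : a * a ^+ 2 <= b * b ^+ 2 by rewrite ler_pM ?sqr_ge0.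
lra.
Qed.

End RateSums.

Section Telescope.
Context {R : realType} {d m : nat} (K : set 'rV[R]_d) (w : 'rV[R]_d -> R).
Context (W : nat -> 'M[R]_m) (B : nat) (zeta : R).
Context (hW : network_assumption zeta B W) (hV : bregman_convex_right K w).

(** Averaging with doubly stochastic weights does not increase the total
    divergence, so the divergences telescope over the rounds. *)
Lemma bregman_mixing t z (y : 'I_m -> 'rV[R]_d) : (0 < t)%N -> K z ->
  (forall j, K (y j)) ->
  \sum_i bregman w z (\sum_j W t i j *: y j) <= \sum_j bregman w z (y j).
Proof.
move=> t0 Kz Ky.
apply: (@le_trans _ _ (\sum_i \sum_j W t i j * bregman w z (y j))).
  apply: ler_sum => i _; apply: hV => //.
  - by move=> j; exact: (mixing_ge0 hW).
  - exact: (mixing_row hW).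
rewrite exchange_big/=; apply: ler_sum => j _.
by rewrite -mulr_suml (mixing_col hW)// mul1r.
Qed.

Lemma bregman_telescope T z (x y : 'I_m -> nat -> 'rV[R]_d) : K z ->
  (forall i t, (1 <= t <= T)%N -> K (y i t)) ->
  (forall i t, (1 <= t <= T)%N -> x i t.+1 = \sum_j W t i j *: y j t) ->
  \sum_(1 <= t < T.+1) \sum_i (bregman w z (x i t) - bregman w z (y i t)) <=
  \sum_i bregman w z (x i 1%N) - \sum_i bregman w z (x i T.+1).
Proof.
move=> Kz; elim: T => [|T IH] Ky hx.
  by rewrite big_geq// subrr.
rewrite big_nat_recr//=.
have le t : (1 <= t <= T)%N -> (1 <= t <= T.+1)%N by move=> /andP[-> /leqW].
have := IH (fun i t h => Ky i t (le t h)) (fun i t h => hx i t (le t h)).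
have TT : (1 <= T.+1 <= T.+1)%N by rewrite leqnn.
have := @bregman_mixing T.+1 z (fun j => y j T.+1) (ltn0Sn T) Kz (fun j => Ky j _ TT).
have -> : \sum_i bregman w z (\sum_j W T.+1 i j *: y j T.+1) =
    \sum_i bregman w z (x i T.+2) by apply: eq_bigr => i _; rewrite hx.
have -> : \sum_i (bregman w z (x i T.+1) - bregman w z (y i T.+1)) =
    \sum_i bregman w z (x i T.+1) - \sum_i bregman w z (y i T.+1).
  by rewrite big_split sumrN.
lra.
Qed.

End Telescope.

(** * Regret along a trajectory *)

Section Shrinking.
Context {R : realType} {d : nat} (K : set 'rV[R]_d).
Context (cK : @convex_set R 'rV[R]_d K) (Rlow xi delta : R).
Context (Rlow0 : 0 < Rlow) (ballK : ball2 Rlow `<=` K).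
Context (xiE : xi = delta / Rlow) (delta0 : 0 < delta) (xi1 : xi < 1).
Implicit Types x e : 'rV[R]_d.

Lemma shrink_ge0 : 0 <= xi.
Proof. by rewrite xiE divr_ge0 ?ltW. Qed.

Lemma shrink_01 : 0 <= 1 - xi <= 1.
Proof. by rewrite subr_ge0 gerBl shrink_ge0 ltW. Qed.

Lemma shrink_center : K 0.
Proof. by apply: ballK; rewrite /ball2/= /norm2 dotv0r sqrtr0 ltW. Qed.

Lemma scale_set_convex (a : R) : @convex_set R 'rV[R]_d (scale_set a K).
Proof.
move=> x y c; rewrite !inE => -[x' Kx' <-] [y' Ky' <-].
exists (c%:num *: x' + (1 - c%:num) *: y').
  by apply: convex_setP => //; apply/andP; split.
by rewrite scalerDr !scalerA ![a * _]mulrC -!scalerA.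
Qed.

Lemma scale_set_sub : scale_set (1 - xi) K `<=` K.
Proof.
move=> _ [x Kx <-]; rewrite -[_ *: x]addr0 -(scaler0 _ (1 - (1 - xi))).
exact: (convex_setP cK Kx shrink_center shrink_01).
Qed.

(** The shrinkage [xi] makes room for the exploration: [x + delta e] is a
    convex combination of a point of [K] and of a point of the inner ball. *)
Lemma scale_set_explore x e : scale_set (1 - xi) K x -> norm2 e = 1 ->
  K (x + delta *: e).
Proof.
move=> [x' Kx' <-] e1.
have -> : delta *: e = (1 - (1 - xi)) *: (Rlow *: e).
  rewrite scalerA; congr (_ *: _); rewrite xiE.
  by field; rewrite gt_eqF.
apply: (convex_setP cK Kx' _ shrink_01); apply: ballK.
by rewrite /ball2/= norm2Z e1 mulr1 gtr0_norm.
Qed.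

End Shrinking.

Section NormConstants.
Context {R : realType} {d : nat} (N : 'rV[R]_d -> R) (hN : is_norm N) (p q : R).
Context (hp : forall x, N x <= p * norm2 x) (d0 : (0 < d)%N).
Context (hq : forall x, dual_norm N x <= q * norm2 x).

Lemma norm_constant_gt0 : 0 < p.
Proof.
pose e : 'rV[R]_d := delta_mx 0 (Ordinal d0).
have e1 : norm2 e = 1 by exact: norm2_delta.
have := hp e; rewrite e1 mulr1; apply: lt_le_trans; apply: is_norm_gt0 => //.
by apply: contra_eq_neq e1 => ->; rewrite /norm2 dotv0r sqrtr0 eq_sym oner_neq0.
Qed.

(** [1 = <e, e> <= dual_norm N e * N e <= q * p] for a unit vector [e]. *)
Lemma norm_constants_ge1 : 1 <= p * q.
Proof.
pose e : 'rV[R]_d := delta_mx 0 (Ordinal d0).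
have e1 : norm2 e = 1 by exact: norm2_delta.
have := dotv_le_dual hN e e; rewrite -sqr_norm2 e1 expr1n => h.
have := hp e; have := hq e; rewrite e1 !mulr1 => hqe hpe.
have Ne := is_norm_ge0 hN e; have p0 := norm_constant_gt0.
apply: le_trans h _; rewrite mulrC.
apply: (@le_trans _ _ (N e * q)); first by rewrite ler_wpM2l.
have q0 : 0 <= q.
  rewrite leNgt; apply/negP => q0.
  have : dual_norm N e * N e <= 0 by rewrite mulr_le0_ge0// (le_trans hqe)// ltW.
  have := dotv_le_dual hN e e; rewrite -sqr_norm2 e1 expr1n; lra.
by rewrite ler_wpM2r.
Qed.

End NormConstants.

Lemma sum_split4 (R : realType) m T (a b c f : 'I_m -> nat -> R) :
  \sum_(1 <= t < T) \sum_i (a i t + b i t + c i t + f i t) =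
  \sum_(1 <= t < T) \sum_i a i t + \sum_(1 <= t < T) \sum_i b i t +
  \sum_(1 <= t < T) \sum_i c i t + \sum_(1 <= t < T) \sum_i f i t.
Proof. by rewrite -!big_split; apply: eq_bigr => t _; rewrite -!big_split. Qed.

(** The summands come from the disagreement of the nodes, the initial
    divergence, the distance and the value error of the inexact proximal steps,
    and the size of the estimators. *)
Definition regret_constant (R : realType) (G Gw sigma Crho D cons : R) : R :=
  let k := Num.sqrt (2 * `|Crho| / sigma) in
  G * cons * (2 * G / sigma + 4 * k) + `|Gw| * D ^+ 2 + 4 * `|Gw| * D * k
  + 4 * `|Crho| + G ^+ 2 / (2 * sigma).

Section Pathwise.
Context {R : realType} {d m : nat} (N r w : 'rV[R]_d -> R) (hN : is_norm N).
Context (K S : set 'rV[R]_d) (W : nat -> 'M[R]_m) (B : nat).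
Context (zeta sigma Gw Gl Gr p q delta D Crho : R).
Context (B0 : (0 < B)%N) (zeta0 : 0 < zeta) (hW : network_assumption zeta B W).
Context (hw : strongly_convex_smooth N sigma Gw K w) (sigma0 : 0 < sigma).
Context (hV : bregman_convex_right K w).
Context (hr : @convex_function R 'rV[R]_d [set: 'rV[R]_d] r).
Context (hrL : lipschitz_wrt N Gr K r).
Context (hp : forall x, N x <= p * norm2 x).
Context (hq : forall x, dual_norm N x <= q * norm2 x) (d0 : (0 < d)%N).
Context (cK : @convex_set R 'rV[R]_d K) (cS : @convex_set R 'rV[R]_d S).
Context (SK : S `<=` K) (delta0 : 0 < delta).
Context (Sball : forall x e, S x -> norm2 e = 1 -> K (x + delta *: e)).
Context (KD : forall x y, K x -> K y -> N (x - y) <= D).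
Context (T : nat) (T0 : (0 < T)%N) (l : 'I_m -> nat -> 'rV[R]_d -> R).
Context (hlL : forall i t, (1 <= t <= T)%N -> lipschitz_wrt N Gl K (l i t)).
Context (rho : nat -> R).
Context (hrho : forall t, (1 <= t <= T)%N -> 0 <= rho t <= Crho / t%:R `^ (3 / 2)).
Context (x y u : 'I_m -> nat -> 'rV[R]_d).
Context (x1 : forall i j, x i 1%N = x j 1%N).
Context (Sx : forall i t, (1 <= t <= T)%N -> S (x i t)).
Context (Sy : forall i t, (1 <= t <= T)%N -> S (y i t)).
Context (u1 : forall i t, (1 <= t <= T)%N -> norm2 (u i t) = 1).
Context (hmix : forall i t, (1 <= t <= T)%N ->
  x i t.+1 = \sum_j W t i j *: y j t).

Let s : R := Num.sqrt T%:R.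
Let A : R := p * q * d%:R.
Let eta : R := 1 / (A * s).
Let G : R := `|Gl| + `|Gr|.
Let g i t := two_point_grad delta (l i t) (x i t) (u i t).

Context (hy : forall i t, (1 <= t <= T)%N ->
  exists2 ys, is_argmin S (prox_objective eta r w (g i t) (x i t)) ys
  & prox_objective eta r w (g i t) (x i t) (y i t) <=
    prox_objective eta r w (g i t) (x i t) ys + rho t).

Let s1 : 1 <= s.
Proof. by rewrite -[1]sqrtr1 ler_sqrt// ler1n. Qed.

Let s0 : 0 < s. Proof. exact: lt_le_trans s1. Qed.

Let A1 : 1 <= A.
Proof.
have pq1 := norm_constants_ge1 hN hp d0 hq.
apply: (le_trans pq1); rewrite /A ler_peMr ?ler1n//.
exact: le_trans pq1.
Qed.

Let A0 : 0 < A. Proof. exact: lt_le_trans A1. Qed.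

Let eta0 : 0 < eta. Proof. by rewrite divr_gt0// mulr_gt0. Qed.

Let eta_ge0 : 0 <= eta. Proof. exact: ltW. Qed.
Let A_ge0 : 0 <= A. Proof. exact: ltW. Qed.
Let s_ge0 : 0 <= s. Proof. exact: ltW. Qed.
Let sigma_ge0 : 0 <= sigma. Proof. exact: ltW. Qed.
Let zeta_ge0 : 0 <= zeta. Proof. exact: ltW. Qed.

Let etaV : eta^-1 = A * s. Proof. by rewrite /eta div1r invrK. Qed.

Let G0 : 0 <= G. Proof. by rewrite addr_ge0. Qed.

Let dual i t b : (1 <= t <= T)%N ->
  dotv (g i t) b + `|Gr| * N b <= G * A * N b.
Proof.
move=> tT; have Nb := is_norm_ge0 hN b.
have := @norm_dotv_two_point_grad _ _ N hN K S Gl p q delta (l i t) hp hq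
  (hlL i tT) delta0 Sball _ _ b (Sx i tT) (u1 i tT).
rewrite -/A => /(le_trans (ler_norm _)) h.
have : `|Gr| * N b <= `|Gr| * A * N b by rewrite ler_wpM2r// ler_peMr.
rewrite /G !mulrDl; move: h; rewrite /g; lra.
Qed.

(* [err t] bounds the distance of [y i t] to the exact minimizer; it is of order
   [sqrt (eta * rho t)]. *)
Let k : R := Num.sqrt (2 * `|Crho| / sigma).
Let err t : R := k * Num.sqrt eta * root4 t ^- 3.

Let k0 : 0 <= k. Proof. exact: sqrtr_ge0. Qed.

Let err0 t : 0 <= err t.
Proof. by rewrite /err !mulr_ge0 ?sqrtr_ge0// invr_ge0 exprn_ge0// sqrtr_ge0. Qed.

Let rho_le t : (1 <= t <= T)%N -> rho t <= `|Crho| * (root4 t ^- 3) ^+ 2.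
Proof.
move=> tT; have /andP[_ /le_trans] := hrho tT; apply.
rewrite powR_root4 (exprM _ 3 2) -exprVn.
by rewrite ler_wpM2r ?sqr_ge0// ler_norm.
Qed.

Let err_sqr t : (1 <= t <= T)%N -> 2 * eta * rho t / sigma <= err t ^+ 2.
Proof.
move=> tT; rewrite /err !exprMn !sqr_sqrtr ?(ltW eta0)//; last first.
  by rewrite divr_ge0 ?mulr_ge0// ltW.
rewrite ler_pdivrMr// (_ : _ * sigma =
   2 * eta * (`|Crho| * (root4 t ^- 3) ^+ 2)); last by move: (root4 t ^- 3) => v; field; rewrite gt_eqF.
by rewrite ler_wpM2l ?rho_le// mulr_ge0// ltW.
Qed.

Let sum_err : \sum_(1 <= t < T.+1) err t <= 4 * k.
Proof.
rewrite /err -mulr_sumr.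
apply: (@le_trans _ _ (k * Num.sqrt eta * (4 * root4 T))).
  by apply: ler_wpM2l; [rewrite mulr_ge0 ?sqrtr_ge0|exact: sum_root4V3].
suff : Num.sqrt eta * root4 T <= 1.
  by move=> /(ler_wpM2l k0); lra.
rewrite /root4 -sqrtrM ?(ltW eta0)// -[leRHS]sqrtr1 ler_sqrt//.
have -> : eta * Num.sqrt T%:R = A^-1.
  by rewrite -/s /eta; field; rewrite !gt_eqF.
by rewrite invf_le1.
Qed.

Let sum_rho : \sum_(1 <= t < T.+1) rho t <= 4 * `|Crho| * s.
Proof.
apply: (@le_trans _ _ (\sum_(1 <= t < T.+1) `|Crho| * root4 t ^- 3)).
  apply: ler_sum_nat => t tT; apply: le_trans (rho_le tT) _.
  rewrite ler_wpM2l// expr2 ler_piMr//.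
    by rewrite invr_ge0 exprn_ge0// sqrtr_ge0.
  have t0 : (0 < t)%N by case/andP: tT.
  by rewrite invf_le1 ?exprn_gt0 ?root4_gt0// exprn_ege1// root4_ge1.
rewrite -mulr_sumr; apply: (@le_trans _ _ (`|Crho| * (4 * root4 T))).
  by rewrite ler_wpM2l// sum_root4V3.
suff : root4 T <= s by move=> /(ler_wpM2l (normr_ge0 Crho)); lra.
by rewrite /s -root42 expr2 ler_peMl ?root4_ge1// sqrtr_ge0.
Qed.

Let cons : R := 4 * (m.+1 * B)%:R / zeta ^+ (m.+1 * B).

Let cons_ge0 : 0 <= cons.
Proof. by rewrite divr_ge0 ?mulr_ge0 ?exprn_ge0. Qed.

Let disagreement i j : \sum_(1 <= t < T.+1) N (x i t - x j t) <=
  cons * (s * (2 * G / sigma + 4 * k)).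
Proof.
pose E t := 2 * eta * (G * A) / sigma + err t.
have E0 t : 0 <= E t.
  apply: addr_ge0; last exact: err0.
  by apply: divr_ge0 => //; do 2![apply: mulr_ge0 => //]; exact: mulr_ge0.
have hE i' t : (1 <= t <= T)%N -> N (y i' t - x i' t) <= E t.
  move=> tT; apply: (prox_drift hN hw hrL SK sigma0 eta0 (Sx i' tT)
    (Sy i' tT) (hy i' tT) (err0 t) (err_sqr tT)) => [b|]; first exact: dual.
  by rewrite mulr_ge0.
have := consensus hN B0 zeta0 hW x1 hmix hE E0 i j.
have al0 : 0 < zeta ^+ (m.+1 * B) by rewrite exprn_gt0.
rewrite mulrC -ler_pdivlMr// => /le_trans; apply.
rewrite mulrAC -/cons; apply: ler_wpM2l => //.
rewrite big_split/= sumr_const_nat subn1/=.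
have -> : 2 * eta * (G * A) / sigma *+ T = s * (2 * G / sigma).
  rewrite -[_ *+ T]mulr_natl (_ : T%:R = s ^+ 2); last by rewrite sqr_sqrtr.
  by rewrite /eta; field; rewrite !gt_eqF.
rewrite [s * (_ + 4 * k)]mulrDr lerD2l; apply: (le_trans sum_err).
by rewrite ler_peMl// mulr_ge0.
Qed.

(** Along one trajectory: consensus replaces the point [x j t] of node [j] by
    the own point [x i t] of node [i], the loss of [i] is linearized there up to
    the bias of the estimator, and the divergences of the proximal steps
    telescope. *)
Lemma pathwise_regret (j : 'I_m) z : S z ->
  \sum_(1 <= t < T.+1) \sum_i
     (l i t (x j t) + r (x j t) - (l i t z + r z)) <=
  \sum_(1 <= t < T.+1) \sum_i
     (l i t (x i t) - l i t z - dotv (g i t) (x i t - z)) +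
  m%:R * (A * s * regret_constant G Gw sigma Crho D cons).
Proof.
move=> Sz; have Kz := SK Sz.
have D0 : 0 <= D by apply: le_trans (KD Kz Kz); exact: is_norm_ge0.
pose a i t := G * N (x j t - x i t).
pose b i t := l i t (x i t) - l i t z - dotv (g i t) (x i t - z).
pose c i t := eta^-1 * (bregman w z (x i t) - bregman w z (y i t)).
pose f (i : 'I_m) t := eta^-1 * (`|Gw| * err t * D) + rho t
  + eta / (2 * sigma) * (G * A) ^+ 2.
apply: (@le_trans _ _ (\sum_(1 <= t < T.+1) \sum_i (a i t + b i t + c i t + f i t))).
  apply: ler_sum_nat => t tT; apply: ler_sum => i _.
  have := prox_regret hN hw hr hrL cS SK sigma0 eta0 (Sx i tT) (Sy i tT) Sz
    (hy i tT) (err0 t) (err_sqr tT) (fun b => dual i b tT) (KD Kz (SK (Sy i tT))).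
  have h1 := lipschitz_wrt_le hN (hlL i tT) (SK (Sx j tT)) (SK (Sx i tT)).
  have h2 := lipschitz_wrt_le hN hrL (SK (Sx j tT)) (SK (Sx i tT)).
  rewrite /a /b /c /f /G mulrDl; lra.
rewrite sum_split4.
have sa : \sum_(1 <= t < T.+1) \sum_i a i t <=
    m%:R * (A * s * (G * cons * (2 * G / sigma + 4 * k))).
  rewrite exchange_big/= -[X in X%:R]card_ord mulr_natl -sumr_const.
  apply: ler_sum => i _; rewrite /a -mulr_sumr.
  apply: (@le_trans _ _ (G * (cons * (s * (2 * G / sigma + 4 * k))))).
    by rewrite ler_wpM2l// disagreement.
  have H0 : 0 <= G * cons * (2 * G / sigma + 4 * k).
    apply: mulr_ge0; first exact: mulr_ge0.
    by apply: addr_ge0; [apply: divr_ge0 => //|]; exact: mulr_ge0.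
  have : 1 * (s * (G * cons * (2 * G / sigma + 4 * k))) <=
      A * (s * (G * cons * (2 * G / sigma + 4 * k))).
    by apply: ler_wpM2r => //; rewrite mulr_ge0.
  lra.
have sc : \sum_(1 <= t < T.+1) \sum_i c i t <= m%:R * (A * s * (`|Gw| * D ^+ 2)).
  rewrite /c; under eq_bigr do rewrite -mulr_sumr.
  rewrite -mulr_sumr etaV.
  have Kx1 i : K (x i 1%N) by apply/SK/Sx; rewrite T0.
  have tel := bregman_telescope hW hV Kz (fun i t tT => SK (Sy i tT)) hmix.
  have last : 0 <= \sum_i bregman w z (x i T.+1).
    apply: sumr_ge0 => i _; apply: (bregman_ge0 hw sigma0) => //.
    have TT : (1 <= T <= T)%N by rewrite T0 leqnn.
    rewrite hmix//; apply: convex_set_sum => //.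
    - by move=> j'; exact: (mixing_ge0 hW).
    - exact: (mixing_row hW).
    - by move=> j'; apply/SK/Sy.
  have first : \sum_i bregman w z (x i 1%N) <= m%:R * (`|Gw| * D ^+ 2).
    rewrite -[X in X%:R]card_ord mulr_natl -sumr_const; apply: ler_sum => i _.
    apply: le_trans (bregman_le hN hw sigma0 Kz (Kx1 i)) _.
    rewrite ler_wpM2l// ler_pXn2r// ?nnegrE ?is_norm_ge0//.
    exact: KD.
  rewrite mulrCA; apply: ler_wpM2l; first by rewrite mulr_ge0.
  by apply: le_trans tel _; apply: le_trans first; rewrite gerBl.
have sf : \sum_(1 <= t < T.+1) \sum_i f i t <=
    m%:R * (A * s * (4 * `|Gw| * D * k + 4 * `|Crho| + G ^+ 2 / (2 * sigma))).
  rewrite exchange_big/= -[X in X%:R]card_ord mulr_natl -sumr_const.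
  apply: ler_sum => i _; rewrite /f !big_split/= sumr_const_nat subn1/=.
  have -> : \sum_(1 <= t < T.+1) eta^-1 * (`|Gw| * err t * D) =
      A * s * (`|Gw| * D) * \sum_(1 <= t < T.+1) err t.
    by rewrite mulr_sumr; apply: eq_bigr => t _; rewrite etaV; ring.
  have -> : eta / (2 * sigma) * (G * A) ^+ 2 *+ T = A * s * (G ^+ 2 / (2 * sigma)).
    rewrite -mulr_natl; have -> : T%:R = s ^+ 2 by rewrite sqr_sqrtr.
    by rewrite /eta; field; rewrite !gt_eqF.
  have e1 : A * s * (`|Gw| * D) * \sum_(1 <= t < T.+1) err t <=
      A * s * (`|Gw| * D) * (4 * k).
    by apply: ler_wpM2l; [apply: mulr_ge0; exact: mulr_ge0 | exact: sum_err].
  have e2 : 1 * (s * (4 * `|Crho|)) <= A * (s * (4 * `|Crho|)).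
    by apply: ler_wpM2r => //; apply: mulr_ge0 => //; exact: mulr_ge0.
  have e3 := sum_rho; lra.
rewrite /regret_constant -/k; move: sa sc sf.
move: (\sum_(1 <= t < T.+1) \sum_i a i t) (\sum_(1 <= t < T.+1) \sum_i c i t).
move: (\sum_(1 <= t < T.+1) \sum_i f i t) (\sum_(1 <= t < T.+1) \sum_i b i t).
move: (G * cons * _) (`|Gw| * D ^+ 2) (4 * `|Gw| * D * k) (4 * `|Crho|).
move: (G ^+ 2 / _) (A * s) (m%:R : R) => t1 t2 t3 t4 t5 t6 t7 sf sb sa sc ha hc hf.
rewrite !mulrDr in hf *; lra.
Qed.

End Pathwise.

(** * Expected regret *)

Lemma argmin_unique (R : realType) (d : nat) (N w : 'rV[R]_d -> R)
    (K S : set 'rV[R]_d) (sigma Gw : R) (a b : 'rV[R]_d) :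
  is_norm N -> strongly_convex_smooth N sigma Gw K w -> 0 < sigma ->
  @convex_set R 'rV[R]_d S -> S `<=` K ->
  is_argmin S w a -> is_argmin S w b -> a = b.
Proof.
move=> hN [_ hw _] sigma0 cS SK [Sa mina] [Sb minb].
pose c := 2^-1 *: a + (1 - 2^-1) *: b.
have Sc : S c by apply: convex_setP => //; lra.
have := hw a c (SK _ Sa) (SK _ Sc); have := hw b c (SK _ Sb) (SK _ Sc).
have cb : b - c = - (a - c) by apply/rowP => k; rewrite !mxE; field.
rewrite cb dotvNr (is_normN hN) => h1 h2.
have := mina _ Sc; have := minb _ Sc => h3 h4.
have : sigma / 2 * N (a - c) ^+ 2 <= 0 by lra.
rewrite pmulr_rle0 ?divr_gt0// => n0.
have /eqP : N (a - c) ^+ 2 == 0 by rewrite eq_le n0 sqr_ge0.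
move/eqP; rewrite sqrf_eq0 (is_norm_eq0 hN) subr_eq0 => /eqP ac.
have : a - b = 2 *: (a - c) by apply/rowP => k; rewrite !mxE; field.
by rewrite {2}ac subrr scaler0 => /eqP; rewrite subr_eq0 => /eqP.
Qed.

Section Run.
Context {R : realType} {d m : nat} (N r w : 'rV[R]_d -> R) (hN : is_norm N).
Context (K : set 'rV[R]_d) (W : nat -> 'M[R]_m) (B : nat) (zeta sigma Gw : R).
Context (hW : network_assumption zeta B W) (sigma0 : 0 < sigma).
Context (hw : strongly_convex_smooth N sigma Gw K w).
Context (T : nat) (l : 'I_m -> nat -> 'rV[R]_d -> R) (rho : nat -> R).
Context (eta delta xi : R) {disp : measure_display} {Om : measurableType disp}
  (Pr : probability Om R) (x y u : 'I_m -> nat -> Om -> 'rV[R]_d).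
Context (hrun : BanODCMD_run Pr K l r w W T eta rho delta xi x y u).
Context (cS : @convex_set R 'rV[R]_d (scale_set (1 - xi) K)).
Context (SK : scale_set (1 - xi) K `<=` K).

Definition past_events (t : nat) : set (set Om) :=
  [set E | exists j s (A : set borelV), [/\ (1 <= s < t)%N, measurable A
    & E = u j s @^-1` A \/ E = y j s @^-1` A]].

Lemma past_events_measurable t : (t <= T.+1)%N ->
  past_events t `<=` @measurable _ Om.
Proof.
move=> tT E [j [s [A [/andP[s1 st] mA hE]]]].
have sT : (1 <= s <= T)%N by rewrite s1 -ltnS (leq_trans st tT).
have [mU _ _] := run_dir hrun j sT; have mY := run_meas hrun j sT.
by case: hE => ->; rewrite -[X in measurable X]setTI; [exact: mU|exact: mY].
Qed.

Lemma run_init_eq i j o o' : x i 1%N o = x j 1%N o'.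
Proof.
exact: argmin_unique hN hw sigma0 cS SK (run_init hrun i o) (run_init hrun j o').
Qed.

Lemma run_iterate i t o : (1 <= t <= T.+1)%N -> scale_set (1 - xi) K (x i t o).
Proof.
case: t => [//|[_|t /andP[_ tT]]]; first by have [] := run_init hrun i o.
have tT' : (1 <= t.+1 <= T)%N by [].
rewrite (run_mix hrun)//; apply: convex_set_sum => //.
- by move=> j; exact: (mixing_ge0 hW).
- exact: (mixing_row hW).
- by move=> j; have [] := run_approx hrun j o tT'.
Qed.

(** The initial point is the only minimizer of [w], hence deterministic; the
    later ones are averages of the approximate minimizers of the round before. *)
Lemma run_past_measurable i t : (1 <= t <= T)%N ->
  @random_vector R d _ (g_sigma_algebraType (past_events t)) (x i t).
Proof.
case: t => [//|[_|t /andP[_ tT]]].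
  rewrite (_ : x i 1%N = fun=> x i 1%N point); first exact: random_vector_cst.
  by apply/funext => o; exact: run_init_eq.
have tT' : (1 <= t.+1 <= T)%N by exact: ltnW.
rewrite (_ : x i t.+2 = fun o => \sum_j W t.+1 i j *: y j t.+1 o); last first.
  by apply/funext => o; rewrite (run_mix hrun).
apply: random_vector_sum => j; apply: random_vectorZ.
move=> _ A mA; rewrite setTI; apply: sub_sigma_algebra.
by exists j, t.+1, A; split; [rewrite /= ltnS leqnn|exact: mA|right].
Qed.

Lemma run_measurable i t : (1 <= t <= T)%N -> random_vector (x i t).
Proof.
move=> /[dup] tT /andP[_ tT'] _ A mA; rewrite setTI.
have := run_past_measurable i tT measurableT mA; rewrite setTI.
apply: smallest_sub; first exact: sigma_algebra_measurable.
exact: past_events_measurable (leqW tT').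
Qed.

End Run.

Unset Implicit Arguments.
Set Strict Implicit.

Theorem corollary2 (R : realType) (m B : nat)
    (zeta G_l G_r sigma G_w R_low R_up pbar pbar_dual C_rho : R)
    (hB : (1 <= B)%N) (hzeta : 0 < zeta) (hsigma : 0 < sigma)
    (hR_low : 0 < R_low) :
  exists C : R,
  forall (d : nat) (N : 'rV[R]_d -> R) (K : set 'rV[R]_d)
    (r w : 'rV[R]_d -> R) (W : nat -> 'M[R]_m),
  (1 <= d)%N ->
  is_norm N ->
  (forall x, N x <= pbar * norm2 x) ->
  (forall x, dual_norm N x <= pbar_dual * norm2 x) ->
  @convex_set R 'rV[R]_d K ->
  @convex_function R 'rV[R]_d [set: 'rV[R]_d] r ->
  network_assumption zeta B W ->
  lipschitz_wrt N G_r K r ->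
  strongly_convex_smooth N sigma G_w K w ->
  bregman_convex_right K w ->
  ball2 R_low `<=` K -> K `<=` ball2 R_up ->
  forall (T : nat) (l : 'I_m -> nat -> 'rV[R]_d -> R) (rho : nat -> R)
    (xstar : 'rV[R]_d)
    (disp : measure_display) (Om : measurableType disp)
    (Pr : probability Om R) (x y u : 'I_m -> nat -> Om -> 'rV[R]_d),
  let delta : R := 1 / Num.sqrt T%:R in
  let xi : R := delta / R_low in
  let eta : R := 1 / (pbar * pbar_dual * d%:R * Num.sqrt T%:R) in
  (1 <= T)%N ->
  xi < 1 ->
  (forall i t, (1 <= t <= T)%N ->
     @convex_function R 'rV[R]_d [set: 'rV[R]_d] (l i t)) ->
  (forall i t, (1 <= t <= T)%N -> lipschitz_wrt N G_l K (l i t)) ->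
  (forall t, (1 <= t <= T)%N -> 0 <= rho t <= C_rho / t%:R `^ (3 / 2)) ->
  is_argmin K (fun z => total_loss l r T (fun=> z)) xstar ->
  BanODCMD_run Pr K l r w W T eta rho delta xi x y u ->
  forall j : 'I_m,
  ('E_Pr[fun o => avg_regret l r T (fun t => x j t o) xstar] <=
     (C * (pbar * pbar_dual * d%:R / Num.sqrt T%:R))%:E)%E.
Proof.
pose G : R := `|G_l| + `|G_r|.
pose D : R := 2 * (pbar * R_up).
pose cons : R := 4 * (m.+1 * B)%:R / zeta ^+ (m.+1 * B).
pose C1 := regret_constant G G_w sigma C_rho D cons.
(* The last two summands pay for the bias of the estimators and for the
   shrinkage of [K]. *)
exists (m%:R * (C1 + 2 * `|G_l| * pbar + G * (pbar * R_up) / R_low)).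
move=> d N K r w W d0 hN hp hq cK hr hW hrL hw hV ballK Kball T l rho xstar.
move=> disp Om Pr x y u delta xi eta T0 xi1 hl hlL hrho [Kxstar _] hrun j.
pose s : R := Num.sqrt T%:R.
have s0 : 0 < s by rewrite sqrtr_gt0 ltr0n.
have Ts : T%:R = s ^+ 2 by rewrite sqr_sqrtr.
have delta0 : 0 < delta by rewrite divr_gt0.
have xi0 : 0 <= xi by rewrite divr_ge0// ltW.
pose S := scale_set (1 - xi) K.
have cS : @convex_set R 'rV[R]_d S by exact: scale_set_convex.
have SK : S `<=` K by exact: (scale_set_sub cK hR_low ballK erefl delta0 xi1).
have Sball a e : S a -> norm2 e = 1 -> K (a + delta *: e).
  exact: (scale_set_explore cK hR_low ballK erefl delta0 xi1).
have p0 := norm_constant_gt0 hN hp d0.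
have pq1 := norm_constants_ge1 hN hp d0 hq.
pose A : R := pbar * pbar_dual * d%:R.
have A1 : 1 <= A.
  apply: (le_trans pq1); rewrite /A ler_peMr ?ler1n//; exact: le_trans pq1.
have Knorm a : K a -> N a <= pbar * R_up.
  by move=> Ka; apply: le_trans (hp a) _; rewrite ler_wpM2l ?(ltW p0)//; exact: Kball.
have KD a b : K a -> K b -> N (a - b) <= D.
  move=> Ka Kb; apply: le_trans (is_normD hN _ _) _.
  by have := Knorm a Ka; have := Knorm b Kb; rewrite (is_normN hN) /D; lra.
have SD a b : S a -> S b -> N (a - b) <= D by move=> /SK Ka /SK; exact: KD.
(* The iterates stay in the shrunk set, so [xstar] is compared through [z]. *)
pose z := (1 - xi) *: xstar.
have Sz : S z by exists xstar.
have Sx i t o : (1 <= t <= T)%N -> S (x i t o).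
  by move=> /andP[t1 tT]; apply: (run_iterate hW hrun cS); rewrite t1 leqW.
pose bias i t o := l i t (x i t o) - l i t z -
  dotv (two_point_grad delta (l i t) (x i t o) (u i t o)) (x i t o - z).
pose Bd := m%:R * (A * s * C1).
pose shift := m%:R * (s * (G * (pbar * R_up) / R_low)).
have path o : \sum_(1 <= t < T.+1) \sum_i
     (l i t (x j t o) + r (x j t o) - (l i t z + r z)) <=
    \sum_(1 <= t < T.+1) \sum_i bias i t o + Bd.
  apply: (@pathwise_regret R d m N r w hN K S W B zeta sigma G_w G_l G_r pbar
    pbar_dual delta D C_rho hB hzeta hW hw hsigma hV hr hrL hp hq d0 cK cS SK
    delta0 Sball KD T T0 l hlL rho hrho (fun i t => x i t o)
    (fun i t => y i t o) (fun i t => u i t o)) => //.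
  - by move=> i i'; exact: (run_init_eq hN hsigma hw hrun cS SK).
  - by move=> i t; exact: Sx.
  - by move=> i t tT; have [] := run_approx hrun i o tT.
  - by move=> i t tT; have [_ h _] := run_dir hrun i tT; exact: h.
  - by move=> i t tT; rewrite (run_mix hrun).
  - by move=> i t tT; have [] := run_approx hrun i o tT.
have zstar : \sum_(1 <= t < T.+1) \sum_i
    (l i t z + r z - (l i t xstar + r xstar)) <= shift.
  have Nz : N (z - xstar) <= xi * (pbar * R_up).
    have -> : z - xstar = - xi *: xstar by apply/rowP => k; rewrite !mxE; ring.
    by rewrite (is_normZ hN) normrN ger0_norm// ler_wpM2l// Knorm.
  apply: (@le_trans _ _ (\sum_(1 <= t < T.+1) \sum_(i < m) G * (xi * (pbar * R_up)))).
    apply: ler_sum_nat => t tT; apply: ler_sum => i _.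
    have h1 := lipschitz_wrt_le hN (hlL i t tT) (SK _ Sz) Kxstar.
    have h2 := lipschitz_wrt_le hN hrL (SK _ Sz) Kxstar.
    have : G * N (z - xstar) <= G * (xi * (pbar * R_up)).
      by rewrite ler_wpM2l// addr_ge0.
    rewrite /G !mulrDl; lra.
  rewrite sumr_const_nat sumr_const card_ord subn1/= -mulrnA -mulr_natl natrM Ts.
  rewrite le_eqVlt; apply/orP; left; apply/eqP; rewrite /shift /xi /delta -/s.
  by field; rewrite !gt_eqF.
have avg o : avg_regret l r T (fun t => x j t o) xstar <=
    T%:R^-1 * (\sum_(t < T) \sum_i bias i t.+1 o + (Bd + shift)).
  rewrite /avg_regret -mulrBr ler_wpM2l ?invr_ge0//.
  have := path o; have := zstar.
  rewrite /total_loss.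
  under eq_bigr do rewrite sumrB; rewrite sumrB.
  under [in X in _ -> X]eq_bigr do rewrite sumrB; rewrite sumrB.
  rewrite [\sum_(1 <= t < T.+1) \sum_i bias i t o]big_add1/= big_mkord; lra.
have mS (h : 'rV[R]_d -> R) Gh i t : lipschitz_wrt N Gh K h -> (1 <= t <= T)%N ->
    bounded_measurable (fun o => h (x i t o)).
  move=> hh tT; apply: (bounded_measurable_lip hN hh SK SD _ _ Sz).
    exact: (run_measurable hN hsigma hw hrun cS SK).
  by move=> o; exact: Sx.
have bmc c := @bounded_measurable_cst R disp Om c.
have bm_bias i (t : 'I_T) : bounded_measurable (bias i t.+1).
  have tT : (1 <= t.+1 <= T)%N by rewrite ltn_ord.
  have [mU U1 _] := run_dir hrun i tT.
  apply: bounded_measurableB; first by apply: bounded_measurableB => //; apply: mS (hlL i _ tT) tT.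
  have mx := run_measurable hN hsigma hw hrun cS SK i tT.
  exact: (bounded_measurable_two_point hN hp hq (hlL i _ tT) d0 delta0 Sball
    SD mx mU (fun o => Sx i _ o tT) U1 Sz).
have bm_biasT : bounded_measurable (fun o => \sum_(t < T) \sum_i bias i t.+1 o).
  by apply: bounded_measurable_sum => t; apply: bounded_measurable_sum.
have bm_reg : bounded_measurable (fun o => avg_regret l r T (fun t => x j t o) xstar).
  apply: bounded_measurableB => //; apply: bounded_measurableM => //.
  rewrite /total_loss; under eq_fun do rewrite big_add1/= big_mkord.
  apply: bounded_measurable_sum => t; apply: bounded_measurable_sum => i.
  have tT : (1 <= t.+1 <= T)%N by rewrite ltn_ord.
  by apply: bounded_measurableD; [apply: mS (hlL i _ tT) tT|apply: mS hrL tT].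
have E_bias i (t : 'I_T) : (\int[Pr]_o bias i t.+1 o <= 2 * `|G_l| * pbar * delta)%R.
  have tT : (1 <= t.+1 <= T)%N by rewrite ltn_ord.
  apply: (@bandit_bias R d N hN K S G_l pbar pbar_dual delta D (l i t.+1) hp hq
    (hl i _ tT) (hlL i _ tT) d0 delta0 SK Sball SD disp Om Pr (past_events y u t.+1)).
  - exact: (run_dir hrun).
  - by apply: (past_events_measurable hrun); rewrite ltnS ltnW.
  - exact: (run_fresh hrun).
  - exact: (run_past_measurable hN hsigma hw hrun cS SK).
  - by move=> o; exact: Sx.
  - by [].
rewrite expectation_bounded// lee_fin.
have bm_bound : bounded_measurable
    (fun o => \sum_(t < T) \sum_i bias i t.+1 o + (Bd + shift)).
  exact: bounded_measurableD.
apply: (le_trans (le_Rintegral_bounded Pr bm_reg (bounded_measurableM (bmc T%:R^-1) bm_bound) avg)).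
rewrite RintegralZl_bounded// RintegralD_bounded// Rintegral_prob_cst.
rewrite Rintegral_sum_bounded; last by move=> t; exact: bounded_measurable_sum.
have sumE : \sum_(t < T) (\int[Pr]_o (\sum_i bias i t.+1 o))%R <=
    m%:R * (A * s * (2 * `|G_l| * pbar)).
  apply: (@le_trans _ _ (\sum_(t < T) \sum_(i < m) 2 * `|G_l| * pbar * delta)).
    apply: ler_sum => t _; rewrite Rintegral_sum_bounded//.
    by apply: ler_sum => i _; exact: E_bias.
  rewrite !sumr_const !card_ord -mulrnA -[_ *+ (m * T)]mulr_natl natrM Ts /delta -/s.
  have : 1 * (m%:R * s * (2 * `|G_l| * pbar)) <= A * (m%:R * s * (2 * `|G_l| * pbar)).
    by rewrite ler_wpM2r// !mulr_ge0// ltW.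
  rewrite (_ : m%:R * s ^+ 2 * _ = m%:R * s * (2 * `|G_l| * pbar)); last first.
    by field; rewrite gt_eqF.
  by rewrite mul1r => /le_trans; apply; rewrite le_eqVlt; apply/orP; left; apply/eqP; ring.
have shiftE : shift <= m%:R * (A * s * (G * (pbar * R_up) / R_low)).
  have X0 : 0 <= G * (pbar * R_up) / R_low.
    apply: divr_ge0; last exact: ltW.
    apply: mulr_ge0; first by rewrite addr_ge0.
    exact: le_trans (is_norm_ge0 hN _) (Knorm _ Kxstar).
  rewrite /shift ler_wpM2l// -[A * s * _]mulrA.
  by apply: ler_peMl => //; apply: mulr_ge0 => //; exact: ltW.
rewrite -/A -/s Ts.
have -> : m%:R * (C1 + 2 * `|G_l| * pbar + G * (pbar * R_up) / R_low) * (A / s) =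
   (s ^+ 2)^-1 * (m%:R * (A * s * (2 * `|G_l| * pbar)) + (Bd + m%:R * (A * s * (G * (pbar * R_up) / R_low)))).
  by rewrite /Bd; field; rewrite !gt_eqF.
by rewrite ler_wpM2l ?invr_ge0 ?sqr_ge0// lerD// lerD2l.
Qed.
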